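(* Let $K$ be a virtual knot. Then $$\mathcal{F}(K)=\sum_{c} w(c)\,\widetilde{K}_c-w(K)\,F(K)\in\mathcal{M}_1^u,$$ computed from any diagram of $K$, is a virtual knot invariant. Here $F(K)$ is the shadow of $K$ without orientation, the sum runs over all real crossing points $c$ of the diagram, $w(c)\in\{\pm1\}$ is the writhe (sign) of $c$, $w(K)=\sum_c w(c)$ is the writhe of the diagram, and $\widetilde{K}_c$ is the unoriented flat virtual knot obtained from $K$ by $0$-smoothing at $c$ and taking the shadow.
   Context: A virtual knot diagram is a generic immersed circle in the plane (finitely many transversal double points), each double point being marked either as a real crossing (with over/under information) or as a virtual crossing. The generalized Reidemeister moves are: the classical Reidemeister moves $\Omega_1,\Omega_2,\Omega_3$ on real crossings; the moves $\Omega_1',\Omega_2',\Omega_3'$, which have the same shapes but with all crossings virtual; and $\Omega_3^v$, a third-Reidemeister-type move in which an arc having only two virtual crossings is moved across one real crossing. A virtual knot is an equivalence class of virtual knot diagrams under these moves (and planar isotopy). A flat virtual knot diagram is defined in the same way, with each real crossing replaced by a flat crossing (no over/under information). The flat generalized Reidemeister moves are obtained from the generalized Reidemeister moves $\Omega_1,\Omega_2,\Omega_3,\Omega_1',\Omega_2',\Omega_3',\Omega_3^v$ by replacing all real crossings with flat crossings. Flat virtual knots are equivalence classes of flat virtual knot diagrams under the flat generalized Reidemeister moves; they are oriented or unoriented according to whether the circle is oriented. The shadow $F(K)$ of a virtual knot diagram $K$ is the flat diagram (and the flat virtual knot it represents) obtained by replacing every real crossing with a flat crossing. A real crossing $c$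 of a virtual knot diagram $K$ has two resolutions (replacing a neighbourhood of the crossing by two disjoint arcs). The $0$-smoothing is the one which preserves the number of components (it is the one not compatible with an orientation of $K$). It gives an unoriented virtual knot diagram $K_c$, and $\widetilde{K}_c=F(K_c)$. $\mathcal{M}_1^u$ is the free $\mathbf{Z}$-module generated by the set of all unoriented flat virtual knots. *)

(* Defs.v *)
From Stdlib Require Import Relation_Operators.
From HB Require Import structures.
From mathcomp Require Import all_boot all_algebra.
From mathcomp Require Import generic_quotient.
From mathcomp.classical Require Import boolp.
From mathcomp Require Import freeg.

Set Implicit Arguments.
Unset Strict Implicit.
Unset Printing Implicit Defensive.

Import GRing.Theory.
Local Open Scope quotient_scope.

(** A generic immersed curve in the plane on which the height function is
    generic is cut by horizontal lines into slices, each containing exactly one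
    local maximum ([Cap]), local minimum ([Cup]) or double point ([Cross x], with
    [x] the kind of crossing), all other strands going straight through.  The
    slice [(k, b)] has the event [b] with exactly [k] strands to the left of it.
    A diagram is the sequence of its slices, from bottom to top. *)

Inductive brick (T : Type) := Cup | Cap | Cross of T.
Arguments Cup {T}.
Arguments Cap {T}.

Section BrickChoice.
Variable T : Type.
Definition brick_code (b : brick T) : option (option T) :=
  match b with Cup => None | Cap => Some None | Cross x => Some (Some x) end.
Definition brick_decode (c : option (option T)) : brick T :=
  match c with None => Cup | Some None => Cap | Some (Some x) => Cross x end.
Lemma brick_codeK : cancel brick_code brick_decode.
Proof. by case. Qed.
End BrickChoice.
HB.instance Definition _ (T : eqType) :=
  Equality.copy (brick T) (can_type (@brick_codeK T)).
HB.instance Definition _ (T : choiceType) :=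
  Choice.copy (brick T) (can_type (@brick_codeK T)).

(** Number of strands of the event below and above it. *)
Definition ins T (b : brick T) : nat := if b is Cup then 0 else 2.
Definition outs T (b : brick T) : nat := if b is Cap then 0 else 2.

Definition map_brick T U (f : T -> U) (b : brick T) : brick U :=
  match b with Cup => Cup | Cap => Cap | Cross x => Cross (f x) end.

Notation word T := (seq (nat * brick T)).

Definition slice T (D : word T) (i : nat) : nat * brick T := nth (0, Cup) D i.

(** Number of points of the curve on the horizontal line below slice [i]. *)
Definition width T (D : word T) (i : nat) : nat :=
  foldl (fun n kb => n - ins kb.2 + outs kb.2) 0 (take i D).

Definition closed_word T (D : word T) : bool :=
  all (fun i => (slice D i).1 + ins (slice D i).2 <= width D i) (iota 0 (size D))
  && (width D (size D) == 0).

(** The arcs contained in one slice; the endpoint [(s, j)] is the [j]-th point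
    (from the left) of the top boundary line of the slice if [s] is true, of its
    bottom boundary line otherwise. *)
Inductive arc T : nat * brick T -> bool * nat -> bool * nat -> Prop :=
| arc_left k b j : j < k -> arc (k, b) (false, j) (true, j)
| arc_right k b j : arc (k, b) (false, k + ins b + j) (true, k + outs b + j)
| arc_cup k : arc (k, Cup) (true, k) (true, k.+1)
| arc_cap k : arc (k, Cap) (false, k) (false, k.+1)
| arc_rising k x : arc (k, Cross x) (false, k) (true, k.+1)
| arc_falling k x : arc (k, Cross x) (false, k.+1) (true, k)
| arc_sym kb p q : arc kb p q -> arc kb q p.

(** [((i, j), up)]: the [j]-th point of the line below slice [i], traversed
    upwards iff [up].  Entering a slice through its bottom line, or leaving it
    through its top line, is moving upwards. *)
Inductive step T (D : word T) : (nat * nat) * bool -> (nat * nat) * bool -> Prop :=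
| Step i (s : bool) j (s' : bool) j' : i < size D ->
    arc (slice D i) (s, j) (s', j') ->
    step D ((i + s, j), ~~ s) ((i + s', j'), s').

Definition travel T (D : word T) := clos_refl_trans _ (step D).

Definition adjacent T (D : word T) (p q : nat * nat) : Prop :=
  exists u v, step D (p, u) (q, v).

Definition connected T (D : word T) := clos_refl_trans _ (adjacent D).

Definition one_component T (D : word T) : Prop :=
  D <> [::] /\ forall p q : nat * nat,
    p.2 < width D p.1 -> q.2 < width D q.1 -> connected D p q.

Definition knot_word T (D : word T) : bool :=
  closed_word D && `[< one_component D >].

(** Diagrams of a single closed curve, unoriented. *)
Definition diagram (T : choiceType) := {D : word T | knot_word D}.

(** The two resolutions of the crossing in slice [i]: two vertical arcs, or a
    maximum below a minimum. *)
Definition resolve T (vertical : bool) (D : word T) (i : nat) : word T :=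
  take i D ++
  (if vertical then [::]
   else [:: ((slice D i).1, Cap); ((slice D i).1, Cup)]) ++
  drop i.+1 D.

Definition is_cross T (b : brick T) : bool := if b is Cross _ then true else false.

Section ResolveKnot.
Variable T : Type.
Implicit Types A B D : word T.

Lemma width0 D : width D 0 = 0.
Proof. by rewrite /width take0. Qed.

Lemma widthS D i : i < size D ->
  width D i.+1 = width D i - ins (slice D i).2 + outs (slice D i).2.
Proof.
by move=> h; rewrite /width (take_nth (0, Cup)) // -cats1 foldl_cat.
Qed.

Lemma closed_wordP D : closed_word D ->
  (forall i, i < size D -> (slice D i).1 + ins (slice D i).2 <= width D i) /\
  width D (size D) = 0.
Proof.
case/andP=> /allP h /eqP h0; split=> // i hi.
by apply: h; rewrite mem_iota.
Qed.

Definition resp (kb : nat * brick T) (r r' : nat -> bool) : Prop :=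
  forall s j s' j', arc kb (s, j) (s', j') ->
    (if s then r' else r) j = (if s' then r' else r) j'.

Lemma respI k b r r' : (forall j, j < k -> r j = r' j) ->
  (forall j, r (k + ins b + j) = r' (k + outs b + j)) ->
  match b with
  | Cup => r' k = r' k.+1
  | Cap => r k = r k.+1
  | Cross _ => r k = r' k.+1 /\ r k.+1 = r' k
  end -> resp (k, b) r r'.
Proof.
move=> hl hr hb s j s' j'.
move E1: (k, b) => kb; move E2: (s, j) => p; move E3: (s', j') => q h.
elim: h s j s' j' E1 E2 E3 => {p q kb}.
- by move=> ? ? ? h ? ? ? ? [E _] [-> ->] [-> ->] /=; rewrite hl ?E.
- by move=> ? ? ? ? ? ? ? [<- <-] [-> ->] [-> ->] /=; rewrite hr.
- by move=> ? ? ? ? ? [<- E] [-> ->] [-> ->]; move: hb; rewrite E.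
- by move=> ? ? ? ? ? [<- E] [-> ->] [-> ->]; move: hb; rewrite E.
- by move=> ? ? ? ? ? ? [<- E] [-> ->] [-> ->]; move: hb; rewrite E => -[].
- by move=> ? ? ? ? ? ? [<- E] [-> ->] [-> ->]; move: hb; rewrite E => -[].
- by move=> ? ? ? _ IH s j s' j' E1 E2 E3; rewrite (IH _ _ _ _ E1 E3 E2).
Qed.

Lemma respE k b r r' : resp (k, b) r r' ->
  [/\ forall j, j < k -> r j = r' j,
      forall j, r (k + ins b + j) = r' (k + outs b + j) &
  match b with
  | Cup => r' k = r' k.+1
  | Cap => r k = r k.+1
  | Cross _ => r k = r' k.+1 /\ r k.+1 = r' k
  end].
Proof.
move=> h; split.
- by move=> j hj; apply: (h false j true j); constructor.
- by move=> j; apply: (h false _ true _); constructor.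
case: b h => [||x] h.
- by apply: (h true _ true _); constructor.
- by apply: (h false _ false _); constructor.
- by split; apply: (h false _ true _); constructor.
Qed.

Lemma resp_odd kb r r' w : resp kb r r' -> kb.1 + ins kb.2 <= w ->
  odd (count r (iota 0 w)) = odd (count r' (iota 0 (w - ins kb.2 + outs kb.2))).
Proof.
case: kb => k b /respE [hl hr hb] /= hw.
have -> : w = k + (ins b + (w - k - ins b)).
  by rewrite -subnDA addnA subnKC.
set m := w - k - ins b.
have -> : k + (ins b + m) - ins b + outs b = k + (outs b + m).
  by rewrite addnCA addKn -addnA [m + _]addnC.
rewrite !iotaD !count_cat !oddD add0n.
congr addb.
  by congr odd; apply: eq_in_count => j; rewrite mem_iota => /hl.
have -> : count r (iota (k + ins b) m) = count r' (iota (k + outs b) m).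
  rewrite -[in LHS](addn0 (k + ins b)) -[in RHS](addn0 (k + outs b)) !iotaDl.
  by rewrite !count_map; apply: eq_count => j /=.
congr addb.
case: b {hl hr hw m} hb => [E|E|x [E1 E2]] /=.
- by rewrite E addn0 oddD addbb.
- by rewrite E addn0 oddD addbb.
- by rewrite E1 E2 !addn0 addnC.
Qed.

Definition labelling D (f : nat -> nat -> bool) : Prop :=
  forall i, i < size D -> resp (slice D i) (f i) (f i.+1).

Lemma labelling_connected D f p q : labelling D f ->
  connected D p q -> f p.1 p.2 = f q.1 q.2.
Proof.
move=> hf; elim=> {p q} [p q [u [v h]]|//|p q r _ -> _ //].
move E1: (p, u) h => a; move E2: (q, v) => b h.
case: h E1 E2 => i s j s' j' hi ha [-> _] [-> _] /=.
by have := hf i hi _ _ _ _ ha; case: (s); case: (s'); rewrite ?addn0 ?addn1.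
Qed.

Lemma connected_sym D p q : connected D p q -> connected D q p.
Proof.
elim=> {p q} [p q [u [v h]]|p|p q r _ h1 _ h2].
- apply: rt_step; move E1: (p, u) h => a; move E2: (q, v) => b h.
  case: h E1 E2 => i s j s' j' hi /arc_sym ha [-> _] [-> _] /=.
  by exists (~~ s'), s; constructor.
- exact: rt_refl.
- exact: rt_trans h2 h1.
Qed.

Lemma not_connected_labelling D p q : ~ connected D p q ->
  exists2 f, labelling D f & f p.1 p.2 <> f q.1 q.2.
Proof.
move=> h; exists (fun i j => `[< connected D p (i, j) >]); last first.
  rewrite -!surjective_pairing => E; apply: h; apply/asboolP; rewrite -E.
  by apply/asboolP; apply: rt_refl.
move=> i hi s j s' j' ha.
have hij : adjacent D (i + s, j) (i + s', j').
  by exists (~~ s), s'; constructor.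
suff : `[< connected D p (i + s, j) >] = `[< connected D p (i + s', j') >].
  by move=> {ha hij}; case: s; case: s'; rewrite ?addn0 ?addn1.
apply: asbool_equiv_eq; split=> hc.
  by apply: rt_trans hc _; apply: rt_step.
by apply: rt_trans hc _; apply: connected_sym; apply: rt_step.
Qed.

Lemma not_one_component D : D <> [::] -> ~ one_component D ->
  exists f p q, [/\ labelling D f, p.2 < width D p.1, q.2 < width D q.1 &
    f p.1 p.2 <> f q.1 q.2].
Proof.
move=> D0 h; apply: contrapT => h'; apply: h; split=> // p q hp hq.
apply: contrapT => /not_connected_labelling [f hf hpq]; apply: h'.
by exists f, p, q.
Qed.

Lemma one_component_labelling D f p q : one_component D -> labelling D f ->
  p.2 < width D p.1 -> q.2 < width D q.1 -> f p.1 p.2 = f q.1 q.2.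
Proof. by move=> [_ h] hf hp hq; apply: labelling_connected (h _ _ hp hq). Qed.

Definition wd (n : nat) D : nat :=
  foldl (fun n kb => n - ins kb.2 + outs kb.2) n D.

Lemma width_catl A B l : l <= size A -> width (A ++ B) l = width A l.
Proof. by move=> h; rewrite /width takel_cat. Qed.

Lemma width_catr A B l : width (A ++ B) (size A + l) =
  wd (width A (size A)) (take l B).
Proof.
by rewrite /width take_size take_cat ltnNge leq_addr /= addKn foldl_cat.
Qed.

Lemma slice_catl A B l : l < size A -> slice (A ++ B) l = slice A l.
Proof. by move=> h; rewrite /slice nth_cat h. Qed.

Lemma slice_catr A B l : slice (A ++ B) (size A + l) = slice B l.
Proof. by rewrite /slice nth_cat ltnNge leq_addr /= addKn. Qed.

Lemma closed_wordI D :
  (forall i, i < size D -> (slice D i).1 + ins (slice D i).2 <= width D i) ->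
  width D (size D) = 0 -> closed_word D.
Proof.
move=> h h0; apply/andP; split; last exact/eqP.
by apply/allP => i; rewrite mem_iota add0n => /h.
Qed.

Lemma leq_case (n l : nat) : l < n \/ exists m, l = n + m.
Proof.
case: (ltnP l n) => h; first by left.
by right; exists (l - n); rewrite subnKC.
Qed.

Lemma resolve_knot_cat A k x B :
  let c := (k, Cross x) in
  knot_word (A ++ c :: B) ->
  knot_word (A ++ B) || knot_word (A ++ (k, Cap) :: (k, Cup) :: B).
Proof.
move=> c /andP [cD /asboolP kD]; set D := A ++ c :: B in cD kD.
set V := A ++ B; set H := A ++ _.
have [hD D0] := closed_wordP cD.
set n := size A; set w := width A n.
have sD : size D = n + (size B).+1 by rewrite size_cat.
have sV : size V = n + size B by rewrite size_cat.
have sH : size H = n + (size B).+2 by rewrite size_cat.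
have slc : slice D n = c by rewrite -[n]addn0 slice_catr.
have wDn : width D n = w by rewrite width_catl.
have hw : k + 2 <= w.
  have := hD n; rewrite slc wDn sD -[X in X < _]addn0 ltn_add2l; exact.
have w2 : w - 2 + 2 = w by rewrite subnK // (leq_trans _ hw) // leq_addl.
have wDr l : width D (n + l.+1) = wd w (take l B).
  by rewrite width_catr /= w2.
have wDl l : l <= n -> width D l = width A l by move=> h; rewrite width_catl.
have wVl l : l <= n -> width V l = width A l by move=> h; rewrite width_catl.
have wHl l : l <= n -> width H l = width A l by move=> h; rewrite width_catl.
have wVr l : width V (n + l) = wd w (take l B) by rewrite width_catr.
have wH1 : width H (n + 1) = w - 2.
  by rewrite width_catr /= addn0.
have wHr l : width H (n + l.+2) = wd w (take l B).
  by rewrite width_catr /= addn0 subn0 w2.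
have sDr l : slice D (n + l.+1) = slice B l by rewrite slice_catr.
have sVr l : slice V (n + l) = slice B l by rewrite slice_catr.
have sHr l : slice H (n + l.+2) = slice B l by rewrite slice_catr.
have sH0 : slice H n = (k, Cap) by rewrite -[n]addn0 slice_catr.
have sH1 : slice H n.+1 = (k, Cup) by rewrite -[n.+1]addn1 slice_catr.
have sDl l : l < n -> slice D l = slice A l by move=> h; rewrite slice_catl.
have sVl l : l < n -> slice V l = slice A l by move=> h; rewrite slice_catl.
have sHl l : l < n -> slice H l = slice A l by move=> h; rewrite slice_catl.
have n0 : A <> [::].
  by move=> E; move: hw; rewrite /w /n E /= width0 addn2.
have V0 : V <> [::] by rewrite /V; case: (A) n0.
have H0 : H <> [::] by rewrite /H; case: (A) n0.
have cV : closed_word V.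
  apply: closed_wordI => [l|]; last by rewrite sV wVr -wDr -sD.
  have [hl _|[m ->]] := leq_case n l.
    rewrite sVl // wVl ?(ltnW hl) // -sDl // -wDl ?(ltnW hl) //; apply: hD.
    by rewrite sD (leq_trans hl) // leq_addr.
  rewrite sV ltn_add2l => hm; rewrite sVr wVr -sDr -wDr; apply: hD.
  by rewrite sD ltn_add2l.
have cH : closed_word H.
  apply: closed_wordI => [l|]; last by rewrite sH wHr -wDr -sD.
  have [hl _|[[|[|m]] ->]] := leq_case n l.
  - rewrite sHl // wHl ?(ltnW hl) // -sDl // -wDl ?(ltnW hl) //; apply: hD.
    by rewrite sD (leq_trans hl) // leq_addr.
  - by rewrite addn0 sH0 wHl // hw.
  - rewrite wH1 addn1 sH1 /= addn0 => _.
    by rewrite leq_subRL 1?addnC // (leq_trans _ hw) // leq_addl.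
  - rewrite sH ltn_add2l => hm; rewrite sHr wHr -sDr -wDr; apply: hD.
    by rewrite sD ltn_add2l.
rewrite /knot_word cV cH /=.
case: (asboolP (one_component V)) => //= /(not_one_component V0).
case=> f [p [q [hf hp hq hpq]]].
apply/asboolP; apply: contrapT => /(not_one_component H0).
case=> g [p' [q' [hg hp' hq' hpq']]].
pose F i := if i <= n then f i else f i.-1.
pose G i := if i <= n then g i else g i.+1.
have FS l : F (n + l.+1) = f (n + l).
  by rewrite /F addnS ltnNge leq_addr.
have GS l : G (n + l.+1) = g (n + l.+2).
  by rewrite /G !addnS ltnNge leq_addr.
have Fl l : l <= n -> F l = f l by rewrite /F => ->.
have Gl l : l <= n -> G l = g l by rewrite /G => ->.
have rF l : l < size D -> l <> n -> resp (slice D l) (F l) (F l.+1).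
  rewrite sD; have [hl _ _|[[|m] ->]] := leq_case n l.
  - rewrite !Fl ?(ltnW hl) // sDl // -sVl //; apply: hf.
    by rewrite sV (leq_trans hl) // leq_addr.
  - by rewrite addn0.
  - rewrite ltn_add2l => hm _; rewrite -addnS !FS sDr -sVr addnS.
    by apply: hf; rewrite sV ltn_add2l.
have rG l : l < size D -> l <> n -> resp (slice D l) (G l) (G l.+1).
  rewrite sD; have [hl _ _|[[|m] ->]] := leq_case n l.
  - rewrite !Gl ?(ltnW hl) // sDl // -sHl //; apply: hg.
    by rewrite sH (leq_trans hl) // leq_addr.
  - by rewrite addn0.
  - rewrite ltn_add2l => hm _; rewrite -addnS !GS sDr -sHr [n + m.+3]addnS.
    by apply: hg; rewrite sH ltn_add2l.
have Fn : F n.+1 = F n by rewrite -[n.+1]addn1 FS addn0 Fl.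
have nH : n < size H by rewrite sH -[X in X < _]addn0 ltn_add2l.
have nH1 : n.+1 < size H by rewrite sH -[X in X < _]addn1 ltn_add2l.
have := hg n nH; rewrite sH0 => /respE [gl gr gc]; rewrite /= in gr gc.
have := hg n.+1 nH1; rewrite sH1 => /respE [gl' gr' gc']; rewrite /= in gr' gc'.
have Gn : G n = g n by rewrite Gl.
have Gn1 : G n.+1 = g n.+2 by have := GS 0; rewrite addn1 addn2.
have Gleft j : j < k -> G n j = G n.+1 j.
  by move=> hj; rewrite Gn Gn1 gl // gl'.
have Gright j : G n (k + 2 + j) = G n.+1 (k + 2 + j).
  by rewrite Gn Gn1 gr -gr' !addn0.
have nD : n < size D by rewrite sD -[X in X < _]addn0 ltn_add2l.
have Fne : F n k <> F n k.+1.
  move=> E; apply: hpq.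
  have lF : labelling D F.
    move=> l hl; case: (l =P n) => [->|]; last exact: rF.
    by rewrite slc Fn; apply: respI.
  pose t l := if l <= n then l else l.+1.
  have tw l : width D (t l) = width V l.
    rewrite /t; case: leqP => hl; first by rewrite wDl // wVl.
    by have := subnKC (ltnW hl) => <-; rewrite -addnS wDr wVr.
  have tF l : F (t l) = f l.
    rewrite /t; case: leqP => hl; first by rewrite Fl.
    by have := subnKC (ltnW hl) => <-; rewrite -addnS FS.
  rewrite -[f p.1]tF -[f q.1]tF.
  apply: (@one_component_labelling _ _ (t p.1, p.2) (t q.1, q.2) kD lF);
  by rewrite /= tw.
have Gne : G n k <> G n.+1 k.
  move=> E; apply: hpq'.
  have lG : labelling D G.
    move=> l hl; case: (l =P n) => [->|]; last exact: rG.
    rewrite slc; apply: respI => //; split.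
      by rewrite E Gn1 gc'.
    by rewrite -E Gn gc.
  have tH r : r.2 < width H r.1 -> exists2 r' : nat * nat,
      r'.2 < width D r'.1 & G r'.1 r'.2 = g r.1 r.2.
    case: r => l j /=; have [hl|[[|[|m]] ->]] := leq_case n l.
    - rewrite wHl ?(ltnW hl) // => h; exists (l, j) => /=.
        by rewrite wDl ?(ltnW hl).
      by rewrite Gl ?(ltnW hl).
    - rewrite addn0 wHl // => h; exists (n, j) => /=; first by rewrite wDn.
      by rewrite Gl.
    - rewrite wH1 addn1 => h; case: (ltnP j k) => hj.
        exists (n, j) => /=; first by rewrite wDn (leq_trans h) // leq_subr.
        by rewrite Gl // gl.
      exists (n, j + 2) => /=; first by rewrite wDn addnC -ltn_subRL.
      rewrite Gl // -(subnKC hj) -addnA [_ + 2]addnC addnA.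
      by rewrite gr addn0.
    - rewrite wHr -wDr => h; exists (n + m.+1, j) => //=.
      by rewrite GS.
  have [r hr <-] := tH _ hp'; have [r' hr' <-] := tH _ hq'.
  exact: one_component_labelling kD lG hr hr'.
pose h i j := (F i j == F n k) && (G i j == G n k).
have rh l : l < size D -> l <> n -> resp (slice D l) (h l) (h l.+1).
  move=> hl hn s j s' j' ha.
  have := rF l hl hn s j s' j' ha; have := rG l hl hn s j s' j' ha.
  by rewrite /h; case: (s); case: (s') => -> ->.
pose P l := odd (count (h l) (iota 0 (width D l))).
have PS l : l < size D -> l <> n -> P l.+1 = P l.
  move=> hl hn; rewrite /P widthS //.
  by rewrite -(resp_odd (rh l hl hn) (hD l hl)).
have Plow l : l <= n -> P l = false.
  elim: l => [|l IH] hl; first by rewrite /P width0.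
  rewrite PS; first by apply: IH; apply: ltnW.
    exact: ltn_trans hl nD.
  by move=> E; rewrite E ltnn in hl.
have Phigh m : m <= size B -> P (n + m.+1) = P n.+1.
  elim: m => [|m IH] hm; first by rewrite addn1.
  rewrite addnS PS; first by apply: IH; apply: ltnW.
    by rewrite sD ltn_add2l.
  by move/eqP; rewrite -[X in _ == X]addn0 eqn_add2l.
have Pend : P n.+1 = false.
  by rewrite -(Phigh (size B)) // -sD /P D0.
have := Plow n (leqnn n); move: Pend; rewrite /P widthS // slc /= wDn w2.
have -> : w = k + (2 + (w - k - 2)) by rewrite -subnDA addnA subnKC.
rewrite !iotaD !count_cat !oddD add0n.
have -> : count (h n.+1) (iota 0 k) = count (h n) (iota 0 k).
  apply: eq_in_count => j; rewrite mem_iota /= add0n => hj.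
  by rewrite /h Fn -(Gleft j).
set m := w - k - 2.
have -> : count (h n.+1) (iota (k + 2) m) = count (h n) (iota (k + 2) m).
  rewrite -[in LHS](addn0 (k + 2)) -[in RHS](addn0 (k + 2)) !iotaDl.
  rewrite !count_map; apply: eq_count => j /=.
  by rewrite /h Fn -(Gright j).
have h1 : h n k = true by rewrite /h !eqxx.
have h2 : h n k.+1 = false.
  by rewrite /h; case: eqP => // E; case: Fne; rewrite E.
have h3 : h n.+1 k = false.
  by rewrite /h andbC; case: eqP => // E; case: Gne; rewrite E.
have h4 : h n.+1 k.+1 = false by rewrite /h Fn; case: eqP => // E; case: Fne.
rewrite /= h1 h2 h3 h4 /=.
by case: (odd _); case: (odd _).
Qed.

Lemma resolve_knot D i : knot_word D -> i < size D ->
  is_cross (slice D i).2 ->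
  knot_word (resolve true D i) || knot_word (resolve false D i).
Proof.
move=> kD hi; rewrite /resolve /=.
have E : D = take i D ++ slice D i :: drop i.+1 D.
  by rewrite -drop_nth // cat_take_drop.
case Es: (slice D i) E => [k [||x]] //= E _.
by apply: (@resolve_knot_cat _ _ x); rewrite -E.
Qed.

End ResolveKnot.

Section Shadow.
Variables (T U : Type) (f : T -> U).

Definition map_word (D : word T) : word U := [seq (kb.1, map_brick f kb.2) | kb <- D].

Lemma slice_map_word D i : i < size D ->
  slice (map_word D) i = ((slice D i).1, map_brick f (slice D i).2).
Proof. by move=> h; rewrite /slice (nth_map (0, Cup)). Qed.

Lemma width_map_word D i : width (map_word D) i = width D i.
Proof.
rewrite /width -map_take; elim: (take i D) 0 => //= -[k b] E IH n.
by rewrite -IH; case: b.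
Qed.

Lemma arc_map_word kb p q :
  arc kb p q -> arc (kb.1, map_brick f kb.2) p q.
Proof.
elim=> {kb p q} [k b j h|k b j|k|k|k x|k x|kb p q _ h] /=; try by constructor.
by case: b => [||x]; [exact: (arc_right k Cup j)|
  exact: (arc_right k Cap j)|exact: (arc_right k (Cross (f x)) j)].
Qed.

Lemma knot_map_word D : knot_word D -> knot_word (map_word D).
Proof.
case/andP=> /closed_wordP [h h0] /asboolP [D0 hc]; apply/andP; split.
  apply: closed_wordI => [i|]; last by rewrite size_map width_map_word.
  rewrite size_map => hi; rewrite slice_map_word // width_map_word.
  by have := h i hi; case: (slice D i) => k [].
apply/asboolP; split=> [E|p q]; first by apply: D0; case: (D) E.
rewrite !width_map_word => hp hq; elim: (hc p q hp hq) => {p q hp hq}.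
- move=> p q [u [v hs]]; apply: rt_step; exists u, v.
  case: hs => i s j s' j' hi ha; constructor; first by rewrite size_map.
  by rewrite slice_map_word //; apply: arc_map_word.
- by move=> p; apply: rt_refl.
- by move=> p q r _ h1 _ h2; apply: rt_trans h1 h2.
Qed.

End Shadow.

(** Local moves, for an alphabet [T] of crossings: [rot x] is the crossing [x]
    turned by a quarter turn, and [r3 x y z] tells that a third Reidemeister move
    is allowed when [x], [y], [z] are the crossings of the strands 1-2, 1-3, 2-3,
    numbered from left to right at the bottom. *)
Section Moves.
Variables (T : choiceType) (rot : T -> T) (r3 : T -> T -> T -> bool).

Inductive local_move : word T -> word T -> Prop :=
(* Planar isotopy: the height function changes generically except for two events
   passing at the same height, the birth of a minimum and a maximum, or a branch
   with a horizontal tangent at a double point. *)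
| iso_exchange k m a b : local_move
    [:: (k, a); (k + outs a + m, b)] [:: (k + ins a + m, b); (k, a)]
| iso_zigzag_l k : local_move [:: (k.+1, Cup); (k, Cap)] [::]
| iso_zigzag_r k : local_move [:: (k, Cup); (k.+1, Cap)] [::]
| iso_slide_cap k x : local_move
    [:: (k, Cross x); (k.+1, Cap)] [:: (k.+1, Cross (rot x)); (k, Cap)]
| iso_slide_cup k x : local_move
    [:: (k.+1, Cup); (k, Cross x)] [:: (k, Cup); (k.+1, Cross (rot x))]
(* Reidemeister moves; the position of the strands with respect to the vertical
   can be changed by a planar isotopy. *)
| omega1_r k x : local_move
    [:: (k.+1, Cup); (k, Cross x); (k.+1, Cap)] [::]
| omega1_l k x : local_move
    [:: (k, Cup); (k.+1, Cross x); (k, Cap)] [::]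
| omega2 k x : local_move [:: (k, Cross x); (k, Cross (rot x))] [::]
| omega3 k x y z : r3 x y z -> local_move
    [:: (k, Cross x); (k.+1, Cross y); (k, Cross z)]
    [:: (k.+1, Cross z); (k, Cross y); (k.+1, Cross x)].

Definition move (D D' : diagram T) : Prop :=
  exists A L R B, [/\ local_move L R,
    val D = A ++ L ++ B & val D' = A ++ R ++ B].

Definition diagram_equiv : rel (diagram T) :=
  fun D D' => `[< clos_refl_sym_trans _ move D D' >].

Lemma diagram_equiv_refl : reflexive diagram_equiv.
Proof. by move=> D; apply/asboolP; apply: rst_refl. Qed.

Lemma diagram_equiv_sym : symmetric diagram_equiv.
Proof. by move=> D D'; apply: asbool_equiv_eq; split; apply: rst_sym. Qed.

Lemma diagram_equiv_trans : transitive diagram_equiv.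
Proof.
by move=> D' D D'' /asboolP h /asboolP h'; apply/asboolP; apply: rst_trans h h'.
Qed.

Canonical diagram_equivRel := EquivRel diagram_equiv
  diagram_equiv_refl diagram_equiv_sym diagram_equiv_trans.

End Moves.

(** [Real b]: the strand going from bottom left to top right is the upper one
    iff [b]. *)
Inductive vcrossing := Real of bool | Virtual.
Inductive fcrossing := Flat | FlatVirtual.

Definition vcrossing_code (x : vcrossing) : option bool :=
  if x is Real b then Some b else None.
Definition vcrossing_decode (c : option bool) : vcrossing :=
  if c is Some b then Real b else Virtual.
Lemma vcrossing_codeK : cancel vcrossing_code vcrossing_decode.
Proof. by case. Qed.
HB.instance Definition _ := Equality.copy vcrossing (can_type vcrossing_codeK).
HB.instance Definition _ := Choice.copy vcrossing (can_type vcrossing_codeK).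

Definition fcrossing_code (x : fcrossing) : bool :=
  if x is Flat then true else false.
Definition fcrossing_decode (c : bool) : fcrossing :=
  if c then Flat else FlatVirtual.
Lemma fcrossing_codeK : cancel fcrossing_code fcrossing_decode.
Proof. by case. Qed.
HB.instance Definition _ := Equality.copy fcrossing (can_type fcrossing_codeK).
HB.instance Definition _ := Choice.copy fcrossing (can_type fcrossing_codeK).

Definition vrot (x : vcrossing) : vcrossing :=
  if x is Real b then Real (~~ b) else Virtual.

(** Three real crossings: the over/under relation on the strands is not cyclic.
    One real crossing: the arc carrying the two virtual ones moves across it.
    The case of two real crossings (forbidden moves) is excluded. *)
Definition vr3 (x y z : vcrossing) : bool :=
  match x, y, z with
  | Real a, Real b, Real c => (a == b) || (b == c)
  | Virtual, Virtual, _ | Virtual, _, Virtual | _, Virtual, Virtual => true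
  | _, _, _ => false
  end.

Definition flatten_crossing (x : vcrossing) : fcrossing :=
  if x is Real _ then Flat else FlatVirtual.

Definition fr3 (x y z : fcrossing) : bool :=
  match x, y, z with
  | Flat, Flat, Flat => true
  | FlatVirtual, FlatVirtual, _ | FlatVirtual, _, FlatVirtual
  | _, FlatVirtual, FlatVirtual => true
  | _, _, _ => false
  end.

Definition vdiagram := diagram vcrossing.
Definition fdiagram := diagram fcrossing.

Definition virtual_knot := {eq_quot (diagram_equivRel vrot vr3)}.
Definition flat_virtual_knot := {eq_quot (diagram_equivRel id fr3)}.

Definition M1u := {freeg flat_virtual_knot / int}.

Definition shadow (D : vdiagram) : fdiagram :=
  Sub (map_word flatten_crossing (val D)) (knot_map_word _ (valP D)).

Definition flat_class (D : fdiagram) : flat_virtual_knot := \pi_flat_virtual_knot D.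

Section Invariant.
Variable D : vdiagram.

Definition is_real (b : brick vcrossing) : bool :=
  if b is Cross (Real _) then true else false.

Definition real_crossing :=
  {i : 'I_(size (val D)) | is_real (slice (val D) i).2}.

Implicit Type c : real_crossing.

(** Whether the right strand is traversed upwards at the bottom of the crossing
    when the knot is oriented so that the left strand is. *)
Definition parallel c : bool :=
  let i := val (val c) in let k := (slice (val D) i).1 in
  `[< travel (val D) ((i, k), true) ((i, k.+1), true) >].

Definition sign c : int :=
  match (slice (val D) (val c)).2 with
  | Cross (Real b) => if b == parallel c then 1 else -1
  | _ => 0
  end%R.

Definition writhe : int := (\sum_(c : real_crossing) sign c)%R.

Definition smoothing0_word c : word vcrossing :=
  let V := resolve true (val D) (val c) in
  let H := resolve false (val D) (val c) in
  if knot_word V then V else H.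

Lemma smoothing0_knot c : knot_word (smoothing0_word c).
Proof.
have [|kV|kV] := orP (resolve_knot (valP D) (ltn_ord (val c)) _).
- by have := valP c; case: (slice _ _).2 => [||[]].
- by rewrite /smoothing0_word /= kV.
- by rewrite /smoothing0_word /=; case: ifP.
Qed.

(** The resolution of [c] having a single component. *)
Definition smoothing0 c : vdiagram := Sub (smoothing0_word c) (smoothing0_knot c).

Definition calF : M1u :=
  (\sum_(c : real_crossing) << sign c *g flat_class (shadow (smoothing0 c)) >>
   - << writhe *g flat_class (shadow D) >>)%R.

End Invariant.

(* Main.v *)
Require Import Defs.
From mathcomp Require Import all_boot all_algebra generic_quotient freeg.
From Stdlib Require Import Relation_Operators.
From mathcomp.classical Require Import boolp.
From mathcomp Require Import zify.
Local Open Scope quotient_scope.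

(** The sign-weighted sum of [K_c - K] over the real crossings is compared term by
    term before and after each move.  An orientation and the shadow of a
    smoothing are both local data: an orientation of a tangle extends over the
    modified tangle with the same boundary values, so a crossing outside the
    moved tangle keeps its sign, and its two summands change by the same flat
    move.  Inside the tangle, [omega1] contributes nothing since the smoothed kink
    unravels, the two crossings of [omega2] have opposite signs and equal shadow
    smoothings, and the three crossings of [omega3] match in pairs.  Quarter turns
    swap the two resolutions of a crossing, so it is needed that exactly one
    of them has a single component; the 0-smoothing is then the sum of the two
    resolutions, where a diagram with several components counts as [0]. *)

Set Implicit Arguments.
Unset Strict Implicit.
Unset Printing Implicit Defensive.

Import GRing.Theory Defs.

(** * Widths and labellings *)

(** Components and orientations are both handled through boolean labels on the points of the
    horizontal lines: equal along arcs for components, negated at extrema for orientations. A path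
    would have to be rerouted through a replaced tangle, whereas labellings are glued layer by
    layer, so a single study of the relation between the boundary labels of a tangle ([chain])
    serves both purposes. This relation cannot see a closed curve inside a tangle, hence the
    separate condition [boundary_connected].

    The parity count behind [resolve_knot] gives at least one connected resolution. That there is at
    most one comes from following the curve from the crossing until it first returns; for this,
    travelling is turned into an injective map on directed points. The same map yields the existence
    of an orientation.

    A context may close one resolution to a knot and the other to a link, so flat tangles are
    compared in all closed contexts and not only in those producing a knot. *)

Section Widths.
Variable T : Type.
Implicit Types A B D W : word T.

(** The position condition of [closed_word], relative to [w] incoming strands: this form splits
    along concatenations and makes sense for tangles. *)
Fixpoint fits (w : nat) W : bool :=
  if W is kb :: W' then
    (kb.1 + ins kb.2 <= w) && fits (w - ins kb.2 + outs kb.2) W'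
  else true.

Lemma wd_cat n A B : wd n (A ++ B) = wd (wd n A) B.
Proof. exact: foldl_cat. Qed.

Lemma fits_cat w A B : fits w (A ++ B) = fits w A && fits (wd w A) B.
Proof. by elim: A w => //= kb A IH w; rewrite IH andbA. Qed.

Lemma fits_slice w W : fits w W <->
  forall i, i < size W -> (slice W i).1 + ins (slice W i).2 <= wd w (take i W).
Proof.
elim: W w => [|kb W IH] w //=; split=> [/andP [h0 /IH h] [|i] hi //=|h].
  exact: h.
apply/andP; split; first exact: (h 0).
by apply/IH => i hi; apply: (h i.+1).
Qed.

Lemma closed_wordE D : closed_word D = fits 0 D && (wd 0 D == 0).
Proof.
apply/idP/andP => [/closed_wordP [h h0]|[/fits_slice h /eqP h0]].
  split; first by apply/fits_slice.
  by move: h0; rewrite /width take_size => /eqP.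
by apply: closed_wordI h _; rewrite /width take_size.
Qed.

Lemma closed_cat A W B : closed_word (A ++ W ++ B) =
  [&& fits 0 A, fits (wd 0 A) W, fits (wd (wd 0 A) W) B &
      wd (wd (wd 0 A) W) B == 0].
Proof. by rewrite closed_wordE !fits_cat !wd_cat -!andbA. Qed.

End Widths.

Section Labels.
Variable T : Type.
Implicit Types A B D W : word T.
Implicit Types r : nat -> bool.
Implicit Types f g : nat -> nat -> bool.

(** Labels of the points on the lines below and above a slice which agree along
    every arc joining the two lines, and which agree ([t = false]) or differ
    ([t = true]) along minima and maxima.  For [t = true] these are orientations,
    [true] meaning upwards. *)
Definition tresp (t : bool) (kb : nat * brick T) r (r' : nat -> bool) : Prop :=
  let: (k, b) := kb in
  [/\ forall j, j < k -> r j = r' j,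
      forall j, r (k + ins b + j) = r' (k + outs b + j) &
  match b with
  | Cup => r' k = t (+) r' k.+1
  | Cap => r k = t (+) r k.+1
  | Cross _ => r k = r' k.+1 /\ r k.+1 = r' k
  end].

Definition tlab t D f : Prop :=
  forall i, i < size D -> tresp t (slice D i) (f i) (f i.+1).

Lemma respP kb r r' : resp kb r r' <-> tresp false kb r r'.
Proof.
case: kb => k b; split=> [/respE [h1 h2 h3]|[h1 h2 h3]].
  by split=> //; case: b {h2} h3.
by apply: respI => //; case: b {h2} h3.
Qed.

Lemma tlab_false D f : labelling D f <-> tlab false D f.
Proof. by split=> h i /h /respP. Qed.

Definition glue n f g l := if l <= n then f l else g (l - n).

Lemma glueD n f g l : f n = g 0 -> glue n f g (n + l) = g l.
Proof.
move=> h; rewrite /glue; case: ifP => hl; last by congr g; lia.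
have l0 : l = 0 by lia. rewrite l0 addn0; exact: h.
Qed.

Lemma glue_le n f g l : l <= n -> glue n f g l = f l.
Proof. by move=> h; rewrite /glue h. Qed.

Lemma tlab_glue t A W f g : tlab t A f -> tlab t W g -> f (size A) = g 0 ->
  tlab t (A ++ W) (glue (size A) f g).
Proof.
move=> hf hg h i; rewrite size_cat.
case: (leq_case (size A) i) => [hi _|[m ->]].
  by rewrite slice_catl // !glue_le //; [apply: hf|apply: ltnW].
by rewrite ltn_add2l => hm; rewrite slice_catr -addnS !glueD //; apply: hg.
Qed.

Lemma tlab_cat t A W f : tlab t (A ++ W) f ->
  tlab t A f /\ tlab t W (fun l => f (size A + l)).
Proof.
move=> h; split=> i hi.
  by have := h i; rewrite size_cat slice_catl //; apply; rewrite ltn_addr.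
by have := h (size A + i); rewrite size_cat slice_catr ltn_add2l addnS; apply.
Qed.

(** Labels propagate upwards: the line below a slice determines the line above it, except for the
    label [x] of the right end of a new minimum. These three functions are the normal forms of that
    propagation. *)
Definition cupf (t : bool) k x r j :=
  if j < k then r j else if j == k then t (+) x else
  if j == k.+1 then x else r (j - 2).
Definition capf k r j : bool := if j < k then r j else r (j + 2).
Definition crossf k r j : bool :=
  if j == k then r k.+1 else if j == k.+1 then r k else r j.

Lemma tresp_cup t k x r : tresp t (k, Cup) r (cupf t k x r).
Proof.
split=> [j hj|j|]; rewrite /cupf /=; first by rewrite hj.
  by repeat case: ifP => ?; try lia; apply: (congr1 r); lia.
by rewrite !ltnn eqxx; repeat case: ifP => ?; try lia.
Qed.

Lemma tresp_cap t k r : r k = t (+) r k.+1 -> tresp t (k, Cap) r (capf k r).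
Proof.
move=> h; split=> [j hj|j|//]; rewrite /capf /=; first by rewrite hj.
by repeat case: ifP => ?; try lia; apply: (congr1 r); lia.
Qed.

Lemma tresp_cross t k x r : tresp t (k, Cross x) r (crossf k r).
Proof.
split=> [j hj|j|]; rewrite /crossf /=;
  repeat case: ifP => ?; by [lia|apply: (congr1 r); lia|rewrite ?eqxx; split; try lia].
Qed.

Lemma tresp_cupE t k r r' : tresp t (k, Cup) r r' -> r' = cupf t k (r' k.+1) r.
Proof.
case=> hl hr hb; apply: funext => j; rewrite /cupf.
case: ifP => hj; first by rewrite hl.
case: eqP => [->//|hj1]; case: eqP => [->//|hj2].
have := hr (j - k - 2) => /=; rewrite addn0.
have -> : k + (j - k - 2) = j - 2 by lia.
by have -> : k + 2 + (j - k - 2) = j by lia.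
Qed.

Lemma tresp_capE t k r r' : tresp t (k, Cap) r r' ->
  r' = capf k r /\ r k = t (+) r k.+1.
Proof.
case=> hl hr hb; split=> //; apply: funext => j; rewrite /capf.
case: ifP => hj; first by rewrite hl.
have := hr (j - k) => /=; rewrite addn0.
have -> : k + (j - k) = j by lia.
by have -> : k + 2 + (j - k) = j + 2 by lia.
Qed.

Lemma tresp_crossE t k x r r' : tresp t (k, Cross x) r r' -> r' = crossf k r.
Proof.
case=> hl hr [h1 h2]; apply: funext => j; rewrite /crossf.
case: eqP => [->//|hj1]; case: eqP => [->//|hj2].
case: (ltnP j k) => hj; first by rewrite hl.
have := hr (j - k - 2) => /=.
by have -> : k + 2 + (j - k - 2) = j by lia.
Qed.

End Labels.
Arguments tresp : simpl never.

(** * Labellings under local moves *)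

Section Chains.
Variable T : Type.
Implicit Types A B D W : word T.
Implicit Types r : nat -> bool.

(** The relation between bottom and top labels induced by a tangle, with the inner lines quantified
    away; tangles with the same relation can replace each other inside a labelling. *)
Fixpoint chain (t : bool) W r (r' : nat -> bool) : Prop :=
  if W is kb :: W' then exists r1, tresp t kb r r1 /\ chain t W' r1 r'
  else r = r'.

Lemma chainP t W r r' : chain t W r r' <->
  exists f, [/\ tlab t W f, f 0 = r & f (size W) = r'].
Proof.
elim: W r => [|kb W IH] r /=.
  split=> [->|[f [_ <- <-]] //]; by exists (fun=> r').
split=> [[r1 [h1 /IH [f [hf f0 fs]]]]|[f [hf <- hs]]].
  exists (fun l => if l is l'.+1 then f l' else r); split=> //.
  by move=> [|i] hi /=; [rewrite f0|apply: hf].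
exists (f 1); split; first exact: (hf 0).
by apply/(IH (f 1)); exists (fun l => f l.+1); split=> // i; apply: (hf i.+1).
Qed.

Lemma chain_cup t k W r r' : chain t ((k, Cup) :: W) r r' =
  exists x, chain t W (cupf t k x r) r'.
Proof.
apply: propext; split=> [[r1 [/tresp_cupE -> h]]|[x h]]; first by exists (r1 k.+1).
by exists (cupf t k x r); split=> //; apply: tresp_cup.
Qed.

Lemma chain_cap t k W r r' : chain t ((k, Cap) :: W) r r' =
  (r k = t (+) r k.+1 /\ chain t W (capf k r) r').
Proof.
apply: propext; split=> [[r1 [/tresp_capE [-> hk] h]]|[hk h]]; first by split.
by exists (capf k r); split=> //; apply: tresp_cap.
Qed.

Lemma chain_cross t k x W r r' : chain t ((k, Cross x) :: W) r r' =
  chain t W (crossf k r) r'.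
Proof.
apply: propext; split=> [[r1 [h1 h2]]|h].
  by rewrite -(tresp_crossE h1).
by exists (crossf k r); split=> //; apply: tresp_cross.
Qed.


Lemma chain_nil t r r' : chain t [::] r r' = (r = r').
Proof. by []. Qed.

End Chains.
Arguments chain : simpl never.

Ltac split_ifs := rewrite /cupf /capf /crossf /=;
  repeat (case: ifP => ? //=; try by exfalso; lia);
  try (by exfalso; lia);
  try (by match goal with |- ?r _ = ?r _ => apply: (congr1 r); lia end).

Ltac chain_in := repeat match goal with
  | H : chain _ ((_, Cup) :: _) _ _ |- _ =>
      rewrite chain_cup in H; destruct H as [? H]
  | H : chain _ ((_, Cap) :: _) _ _ |- _ =>
      rewrite chain_cap in H; destruct H as [? H]
  | H : chain _ ((_, Cross _) :: _) _ _ |- _ => rewrite chain_cross in H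
  | H : chain _ [::] _ _ |- _ => rewrite chain_nil in H; subst
  end.

Ltac chain_cond := repeat match goal with
    H : _ = _ (+) _ |- _ => move: H end; split_ifs; intros;
  first [done | match goal with
    H : ?r _ = ?t (+) ?r _ |- ?r _ = ?t (+) ?r _ =>
      apply: (eq_trans (eq_trans (congr1 r _) H)
        (congr1 (fun u => t (+) r u) _)); lia end].

(** The free label of a minimum is searched, with backtracking, among the booleans in the context,
    where [chain_in] has put those of the other side of the move. *)
Ltac chain_out := rewrite ?chain_cross; match goal with
  | |- chain _ ((_, Cap) :: _) _ _ =>
      rewrite chain_cap; split; [solve [chain_cond] | chain_out]
  | |- chain _ ((_, Cup) :: _) _ _ => rewrite chain_cup;
      match goal with x : bool |- _ => exists x; solve [chain_out] end
  | |- chain _ [::] _ _ =>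
      rewrite chain_nil; apply: funext => j; split_ifs
  end.

Section LocalChain.
Variables (T : choiceType) (rot : T -> T) (r3 : T -> T -> T -> bool).

Lemma chain_exchange t k m (a b : brick T) r r' :
  chain t [:: (k, a); (k + outs a + m, b)] r r' <->
  chain t [:: (k + ins a + m, b); (k, a)] r r'.
Proof. by case: a => [||x]; case: b => [||y] /=; split=> h; chain_in; chain_out. Qed.

(** For the zigzags and kinks, which become a straight strand: following the strand forces the label
    of the minimum to be a value [c] read off the bottom line. *)
Lemma chain_loop t k (W : word T) c r r' :
  (forall x, chain t W (cupf t k x r) r' <-> x = c /\ r = r') ->
  chain t ((k, Cup) :: W) r r' <-> chain t ([::] : word T) r r'.
Proof.
move=> h; rewrite chain_cup chain_nil; split=> [[x /h []] //|hr].
by exists c; apply/h.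
Qed.

(** A move preserves which boundary points are joined and the parity of the number of extrema
    between them; this settles both values of [t] at once. *)
Lemma chain_local t L R r r' : local_move rot r3 L R ->
  chain t L r r' <-> chain t R r r'.
Proof.
case=> [k m a b|k|k|k x|k x|k x|k x|k x|k x y z _] /=.
- exact: chain_exchange.
- apply: (chain_loop (c := r k)) => x.
  split=> [h|[-> <-]]; chain_in.
    have e : x = r k by move: H; split_ifs; case: (t); case: (x); case: (r k).
    by split=> //; subst x; apply: funext => j; split_ifs.
  rewrite chain_cap chain_nil; split; first by split_ifs; rewrite addbA addbb.
  by apply: funext => j; split_ifs.
- apply: (chain_loop (c := t (+) r k)) => x.
  split=> [h|[-> <-]]; chain_in.
    have e : x = t (+) r k.
      by move: H; split_ifs; rewrite ?subn2 /=; case: (t); case: (x); case: (r k).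
    split=> //; subst x; apply: funext => j; split_ifs;
      rewrite addbA addbb; congr (r _); lia.
  rewrite chain_cap chain_nil; split; first by split_ifs; rewrite subn2.
  apply: funext => j; split_ifs; rewrite addbA addbb; congr (r _); lia.
- by split=> h; chain_in; chain_out.
- by split=> h; chain_in; chain_out.
- apply: (chain_loop (c := t (+) r k)) => y.
  split=> [h|[-> <-]]; chain_in.
    have e : y = t (+) r k.
      by move: H; split_ifs; case: (t); case: (y); case: (r k).
    split=> //; subst y; apply: funext => j; split_ifs;
      rewrite addbA addbb; congr (r _); lia.
  rewrite chain_cross chain_cap chain_nil; split; first by split_ifs; rewrite addbA addbb.
  apply: funext => j; split_ifs; rewrite addbA addbb; congr (r _); lia.
- apply: (chain_loop (c := r k)) => y.
  split=> [h|[-> <-]]; chain_in.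
    have e : y = r k.
      by move: H; split_ifs; rewrite ?subn2 /=; case: (t); case: (y); case: (r k).
    by split=> //; subst y; apply: funext => j; split_ifs.
  rewrite chain_cross chain_cap chain_nil; split.
    by split_ifs; rewrite subn2.
  by apply: funext => j; split_ifs.
- by split=> h; chain_in; chain_out.
- by split=> h; chain_in; chain_out.
Qed.
End LocalChain.

(** * Number of components under local moves *)

Section Constant.
Variable T : Type.
Implicit Types (A B D W : word T) (r : nat -> bool) (f : nat -> nat -> bool).

Definition const_below (c : bool) n r := forall j, j < n -> r j = c.

(** A minimum is excluded because its ends are joined to no point of the lower line; dually for a
    maximum in [const_below_slice]. *)
Lemma const_above_slice c w (kb : nat * brick T) r r' : tresp false kb r r' ->
  kb.1 + ins kb.2 <= w -> kb.2 <> Cup ->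
  const_below c w r -> const_below c (w - ins kb.2 + outs kb.2) r'.
Proof.
case: kb => k [||x] //= h hw _ hc j hj.
  by have [-> _] := tresp_capE h; split_ifs; apply: hc; lia.
by rewrite (tresp_crossE h); split_ifs; apply: hc; lia.
Qed.

Lemma const_below_slice c w (kb : nat * brick T) r r' : tresp false kb r r' ->
  kb.1 + ins kb.2 <= w -> kb.2 <> Cap ->
  const_below c (w - ins kb.2 + outs kb.2) r' -> const_below c w r.
Proof.
case: kb => k b [hl hr hb] /= hw hcap hc j hj.
case: (ltnP j k) => hjk; first by rewrite hl //; apply: hc; lia.
case: (ltnP j (k + ins b)) => hjk2; last first.
  rewrite -(subnKC hjk2) hr; apply: hc; lia.
case: b hw hj hcap hjk2 hc hb {hr} => [||x] /= hw hj hcap hjk2 hc hb //; first lia.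
case: hb => h1 h2.
have [->|->] : j = k \/ j = k.+1 by lia.
  by rewrite h1; apply: hc; lia.
by rewrite h2; apply: hc; lia.
Qed.

(** Every component of the tangle meets its boundary. *)
Definition boundary_connected w W := forall f c, tlab false W f ->
  const_below c w (f 0) -> const_below c (wd w W) (f (size W)) ->
  forall l, l <= size W -> const_below c (wd w (take l W)) (f l).

Lemma boundary_connected2 w (a b : nat * brick T) :
  (forall r r1 r2 c, tresp false a r r1 -> tresp false b r1 r2 ->
    const_below c w r -> const_below c (wd w [:: a; b]) r2 ->
    const_below c (wd w [:: a]) r1) -> boundary_connected w [:: a; b].
Proof.
move=> h f c hf h0 h2 [|[|[|l]]] //= _.
exact: (h (f 0) (f 1) (f 2) c (hf 0 isT) (hf 1 isT)).
Qed.

Lemma boundary_connected3 w (a b d : nat * brick T) :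
  (forall r r1 r2 r3 c, tresp false a r r1 -> tresp false b r1 r2 ->
    tresp false d r2 r3 ->
    const_below c w r -> const_below c (wd w [:: a; b; d]) r3 ->
    const_below c (wd w [:: a]) r1 /\ const_below c (wd w [:: a; b]) r2) ->
  boundary_connected w [:: a; b; d].
Proof.
move=> h f c hf h0 h3.
have [h1 h2] :=
  h (f 0) (f 1) (f 2) (f 3) c (hf 0 isT) (hf 1 isT) (hf 2 isT) h0 h3.
by case=> [|[|[|[|l]]]].
Qed.

Lemma boundary_connected_nil w : boundary_connected w ([::] : word T).
Proof. by move=> f c _ h0 _ [|l]. Qed.

Lemma boundary_connected_exchange w k m (a b : brick T) :
  k + ins a + m + ins b <= w ->
  boundary_connected w [:: (k, a); (k + outs a + m, b)] /\
  boundary_connected w [:: (k + ins a + m, b); (k, a)].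
Proof.
move=> hw; split; apply: boundary_connected2 => r r1 r2 c h1 h2 /= hr hr2.
  have [Ea|Ea] : a = Cup \/ a <> Cup by case: (a) => *; by [left|right].
    have [Eb|Eb] : b = Cap \/ b <> Cap by case: (b) => *; by [left|right].
      (* A minimum followed by a maximum is the one case where neither outer line controls the
         middle one slice by slice. The exchange keeps the two apart, so the right end of the
         minimum survives on the top line and [x] is read there. *)
      subst a b; rewrite (tresp_cupE h1) /= in hw h2 hr2 *.
      set x := r1 k.+1 in h2 *.
      have [E _] := tresp_capE h2; subst r2.
      have := hr2 k.+1; split_ifs; move=> hx j hj; split_ifs;
        by first [apply: hx; lia | apply: hr; lia].
    by apply: (const_below_slice h2) => //=; lia.
  by apply: (const_above_slice h1) => //=; lia.
have [Eb|Eb] : b = Cup \/ b <> Cup by case: (b) => *; by [left|right].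
  have [Ea|Ea] : a = Cap \/ a <> Cap by case: (a) => *; by [left|right].
    subst a b; rewrite (tresp_cupE h1) /= in hw h2 hr2 *.
    set x := r1 _ in h2 *.
    have [E _] := tresp_capE h2; subst r2.
    have := hr2 (k + m); split_ifs; move=> hx j hj; split_ifs;
        by first [apply: hx; lia | apply: hr; lia].
  by apply: (const_below_slice h2) => //=; lia.
by apply: (const_above_slice h1) => //=; lia.
Qed.

End Constant.

Section LocalConstant.
Variables (T : choiceType) (rot : T -> T) (r3 : T -> T -> T -> bool).

Lemma fits_local w L R : local_move rot r3 L R -> fits w L ->
  fits w R /\ wd w R = wd w L.
Proof.
case=> [k m a b|k|k|k x|k x|k x|k x|k x|k x y z _] /=; rewrite /wd /=; lia.
Qed.

(** No side of a move contains a closed curve. In a zigzag or a kink the condition at the maximum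
    equates the label of the minimum with a label of the bottom line. *)
Lemma boundary_connected_local w L R : local_move rot r3 L R -> fits w L ->
  boundary_connected w L /\ boundary_connected w R.
Proof.
move=> hm; have hfit := @fits_local w _ _ hm.
case: hm hfit => [k m a b|k|k|k x|k x|k x|k x|k x|k x y z _] hfit hw;
  have [hR _] := hfit hw; move: hw hR => /= hw hR.
- by apply: boundary_connected_exchange; lia.
- split; last exact: boundary_connected_nil.
  apply: boundary_connected2 => r r1 r2 c h1 h2 /= hr hr2.
  rewrite (tresp_cupE h1) in h2 *; set x := r1 _ in h2 *.
  have [_ ] := tresp_capE h2; split_ifs => hx.
  have {}hx : x = c by rewrite -hx; apply: hr; lia.
  by move=> j hj; split_ifs; apply: hr; lia.
- split; last exact: boundary_connected_nil.
  apply: boundary_connected2 => r r1 r2 c h1 h2 /= hr hr2.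
  rewrite (tresp_cupE h1) in h2 *; set x := r1 _ in h2 *.
  have [_ ] := tresp_capE h2; split_ifs => hx.
  have {}hx : x = c by rewrite hx; apply: hr; lia.
  by move=> j hj; split_ifs; apply: hr; lia.
- split; apply: boundary_connected2 => r r1 r2 c h1 h2 /= hr hr2;
    by apply: (const_above_slice h1) => //=; lia.
- split; apply: boundary_connected2 => r r1 r2 c h1 h2 /= hr hr2;
    by apply: (const_below_slice h2) => //=; lia.
- split; last exact: boundary_connected_nil.
  apply: boundary_connected3 => r r1 r2 r4 c h1 h2 h3 /= hr hr2.
  rewrite (tresp_crossE h2) in h3 *.
  rewrite (tresp_cupE h1) in h3 *; set x' := r1 _ in h3 *.
  have [_ ] := tresp_capE h3; split_ifs => hx.
  have {}hx : x' = c by rewrite -hx; apply: hr; lia.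
  by split=> j hj; split_ifs; apply: hr; lia.
- split; last exact: boundary_connected_nil.
  apply: boundary_connected3 => r r1 r2 r4 c h1 h2 h3 /= hr hr2.
  rewrite (tresp_crossE h2) in h3 *.
  rewrite (tresp_cupE h1) in h3 *; set x' := r1 _ in h3 *.
  have [_ ] := tresp_capE h3; split_ifs => hx.
  have {}hx : x' = c by rewrite hx; apply: hr; lia.
  by split=> j hj; split_ifs; apply: hr; lia.
- split; last exact: boundary_connected_nil.
  apply: boundary_connected2 => r r1 r2 c h1 h2 /= hr hr2;
    by apply: (const_above_slice h1) => //=; lia.
- split; apply: boundary_connected3 => r r1 r2 r4 c h1 h2 h3 /= hr hr2;
  (have hh : const_below c (w - 2 + 2) r1 
     by apply: (const_above_slice h1) => //=; lia);
  split=> //; apply: (const_above_slice h2) => //=; lia.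
Qed.

End LocalConstant.

Section KnotLocal.
Variable T : Type.
Implicit Types (A B D W L R : word T) (f : nat -> nat -> bool).

Definition const_lab c D f := 
  forall l, l <= size D -> const_below c (width D l) (f l).

Lemma width_catA A B l : width (A ++ B) (size A + l) = wd (wd 0 A) (take l B).
Proof. by rewrite width_catr /width take_size. Qed.

Lemma width_over D l : size D <= l -> width D l = width D (size D).
Proof. by move=> h; rewrite /width take_oversize // take_size. Qed.

(** Indicator functions of components are labellings, so two values suffice to detect a
    disconnection. *)
Lemma one_component_const D : D <> [::] -> closed_word D ->
  one_component D <-> forall f, tlab false D f -> exists c, const_lab c D f.
Proof.
move=> D0 /closed_wordP [_ Dn]; split=> [kD f hf|h].
  have [[p hp]|h] := pselect (exists p : nat * nat, p.2 < width D p.1).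
    exists (f p.1 p.2) => l hl j hj; apply: esym.
    exact: (@one_component_labelling _ _ _ p (l, j) kD (proj2 (tlab_false _ _) hf)).
  by exists true => l _ j hj; case: h; exists (l, j).
apply: contrapT => /(not_one_component D0) [f [p [q [/tlab_false hf hp hq]]]].
have [c hc] := h f hf; apply.
have le r : r.2 < width D r.1 -> r.1 <= size D.
  by move=> hr; case: leqP => // /ltnW hs; move: hr; rewrite width_over ?Dn.
by rewrite (hc _ (le _ hp)) // (hc _ (le _ hq)).
Qed.

Lemma const_lab_cat c A W B f : const_lab c (A ++ W ++ B) f <->
  [/\ forall l, l <= size A -> const_below c (wd 0 (take l A)) (f l),
      forall l, l <= size W ->
        const_below c (wd (wd 0 A) (take l W)) (f (size A + l)) &
      forall l, l <= size B ->
        const_below c (wd (wd (wd 0 A) W) (take l B)) (f (size A + size W + l))].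
Proof.
split=> [h|[hA hW hB] l].
  split=> l hl.
  - have := h l; rewrite width_catl // size_cat; apply; lia.
  - have := h (size A + l); rewrite width_catA takel_cat // !size_cat; apply; lia.
  - have := h (size A + size W + l).
    rewrite catA -size_cat width_catA wd_cat !size_cat; apply; lia.
rewrite !size_cat => hl.
have [hlA|[m E]] := leq_case (size A) l.
  by rewrite width_catl ?(ltnW hlA) //; apply: hA; apply: ltnW.
subst l; rewrite width_catA.
have [hlW|[p E]] := leq_case (size W) m.
  by rewrite takel_cat ?(ltnW hlW) //; apply: hW; apply: ltnW.
subst m; rewrite take_cat ltnNge leq_addr /= addKn wd_cat addnA.
by apply: hB; lia.
Qed.

(** A labelling of the diagram with [R] is kept outside the tangle and refilled inside by one of
    [L]. It is constant there by hypothesis, hence constant outside the tangle, and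
    [boundary_connected] carries the constant back into [R]. *)
Lemma one_component_tangle A L R B : L <> [::] \/ A ++ B <> [::] ->
  A ++ R ++ B <> [::] ->
  closed_word (A ++ L ++ B) -> closed_word (A ++ R ++ B) ->
  wd (wd 0 A) R = wd (wd 0 A) L ->
  (forall r r', chain false R r r' -> chain false L r r') ->
  boundary_connected (wd 0 A) R ->
  one_component (A ++ L ++ B) -> one_component (A ++ R ++ B).
Proof.
move=> L0 R0 cL cR hwd hch hbc.
have L1 : A ++ L ++ B <> [::].
  by case: (A) L0 => //; case: (L) => // -[].
move=> /(proj1 (one_component_const L1 cL)) kL.
apply/(one_component_const R0 cR) => f.
case/tlab_cat=> fA /tlab_cat [fR fB].
have [g [gL g0 gs]] : exists g, [/\ tlab false L g, g 0 = f (size A) &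
    g (size L) = f (size A + size R)].
  apply/chainP/hch/chainP; exists (fun l => f (size A + l)).
  by rewrite addn0.
pose h := glue (size A) f (glue (size L) g (fun l => f (size A + (size R + l)))).
have g1 : g (size L) = (fun l => f (size A + (size R + l))) 0.
  by rewrite gs addn0.
have g2 : f (size A) = glue (size L) g (fun l => f (size A + (size R + l))) 0.
  by rewrite glue_le.
have [|c /const_lab_cat [hA hL hB]] := kL h.
  by apply: tlab_glue => //; apply: tlab_glue.
exists c; apply/const_lab_cat.
have hA' l : l <= size A -> const_below c (wd 0 (take l A)) (f l).
  by move=> hl; have := hA l hl; rewrite /h glue_le.
have hB' l : l <= size B ->
   const_below c (wd (wd (wd 0 A) R) (take l B)) (f (size A + size R + l)).
  move=> hl; have := hB l hl; rewrite /h -addnA glueD //= glueD //.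
  by rewrite addnA hwd.
split=> // l hl; apply: (hbc (fun l => f (size A + l))) => //.
  by have := hA' _ (leqnn _); rewrite take_size addn0.
by have := hB' 0 isT; rewrite take0 addn0.
Qed.

End KnotLocal.

Section KnotMove.
Variables (T : choiceType) (rot : T -> T) (r3 : T -> T -> T -> bool).

(** [one_component] asks for a nonempty word; a tangle that becomes empty has a strand passing
    through it, which continues outside. *)
Lemma local_nonempty w L R : local_move rot r3 L R -> fits w L ->
  L <> [::] /\ (w = 0 -> R <> [::]).
Proof. by case=> [k m a b|k|k|k x|k x|k x|k x|k x|k x y z _] /=; split=> //; lia. Qed.

Lemma one_component_local A L R B : local_move rot r3 L R ->
  closed_word (A ++ L ++ B) ->
  one_component (A ++ L ++ B) <-> one_component (A ++ R ++ B).
Proof.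
move=> hm cL; have := cL; rewrite closed_cat => /and4P [h1 h2 h3 h4].
have [fR wR] := fits_local hm h2.
have cR : closed_word (A ++ R ++ B) by rewrite closed_cat wR h1 fR h3.
have [L0 R0] := local_nonempty hm h2.
have [bL bR] := boundary_connected_local hm h2.
have AR : A <> [::] \/ R <> [::].
  case: (A) R0 => [|a A'] h; last by left.
  by right; apply: h.
have N (X Y Z : word T) : X <> [::] \/ Y <> [::] -> X ++ Y ++ Z <> [::].
  by case: X => [|? ?] [] //; case: Y.
split; apply: one_component_tangle => //; try by [left|apply: N; by [|right]].
- by move=> r r' /(chain_local false r r' hm).
- case: AR => h; last by left.
  by right; case: (A) h.
- by move=> r r' /(chain_local false r r' hm).
Qed.

Lemma closed_local A L R B : local_move rot r3 L R ->
  closed_word (A ++ L ++ B) -> closed_word (A ++ R ++ B).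
Proof.
move=> hm; rewrite !closed_cat => /and4P [h1 h2 h3 h4].
by have [fR wR] := fits_local hm h2; rewrite wR h1 fR h3.
Qed.

Lemma knot_local A L R B : local_move rot r3 L R ->
  closed_word (A ++ L ++ B) -> knot_word (A ++ L ++ B) = knot_word (A ++ R ++ B).
Proof.
move=> hm cL; rewrite /knot_word cL (closed_local hm cL) /=.
exact/asbool_equiv_eq/one_component_local.
Qed.

End KnotMove.

(** * Travelling along the curve *)

Section Dynamics.
Variable T : Type.
Implicit Types (kb : nat * brick T) (D : word T) (r : nat -> bool).
Implicit Types f : nat -> nat -> bool.

(** Every boundary point of a slice ends exactly one arc, so [arc] is the graph of this involution
    and travelling becomes deterministic. *)
Definition partner kb (p : bool * nat) : bool * nat :=
  let: (k, b) := kb in let: (s, j) := p in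
  let n := if s then outs b else ins b in
  let n' := if s then ins b else outs b in
  if j < k then (~~ s, j)
  else if k + n <= j then (~~ s, j - n + n')
  else (if b is Cross _ then ~~ s else s, if j == k then k.+1 else k).

Lemma arc_partner kb p : arc kb p (partner kb p).
Proof.
case: kb p => k b [s j] /=; case: (ltnP j k) => hj.
  by case: s; [apply: arc_sym|]; apply: arc_left.
case: ifP => hj2.
  case: s hj2 => hj2.
    have -> : j = k + outs b + (j - k - outs b) by lia.
    have -> : k + outs b + (j - k - outs b) - outs b + ins b =
              k + ins b + (j - k - outs b) by lia.
    by apply: arc_sym; apply: arc_right.
  have -> : j = k + ins b + (j - k - ins b) by lia.
  have -> : k + ins b + (j - k - ins b) - ins b + outs b =
            k + outs b + (j - k - ins b) by lia.
  exact: arc_right.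
case: eqP => [->|hjk].
  case: b s hj2 => [||x] [] //= hj2; try lia; try by constructor.
  by apply: arc_sym; apply: arc_falling.
have -> : j = k.+1 by case: b s hj2 => [||x] [] /= hj2; lia.
by case: b s hj2 => [||x] [] //= hj2; try lia;
  by first [exact: arc_falling | apply: arc_sym;
    first [exact: arc_cup | exact: arc_cap | exact: arc_rising]].
Qed.

Lemma partnerK kb : involutive (partner kb).
Proof.
case: kb => k b [s j] /=; case: (ltnP j k) => hj /=.
  by rewrite hj negbK.
case: ifP => hj2.
  have -> : (j - (if s then outs b else ins b) +
    (if s then ins b else outs b) < k) = false by lia.
  by rewrite negbK; case: s hj2 => /= hj2; rewrite ifT; try lia; congr pair; lia.
case: b s hj2 => [||x] [] /= hj2; try (by exfalso; lia);
  by case: eqP => ?; do ?[rewrite ifT; last lia|rewrite ifF; last lia] => //=;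
  congr pair; lia.
Qed.

Lemma arcE kb p q : arc kb p q -> q = partner kb p.
Proof.
elim=> {kb p q} [k b j h|k b j|k|k|k x|k x|kb p q _ ->] /=; last by rewrite partnerK.
- by rewrite h.
- by rewrite ifF; [rewrite ifT; [congr pair; lia|lia]|lia].
- by rewrite ltnn eqxx ifF //; lia.
- by rewrite ltnn eqxx ifF //; lia.
- by rewrite ltnn eqxx ifF //; lia.
- by rewrite !ifF //; lia.
Qed.

Definition state : Type := ((nat * nat) * bool)%type.
Definition reverse (x : state) : state := (x.1, ~~ x.2).

Lemma reverseK : involutive reverse.
Proof. by case=> p u; rewrite /reverse /= negbK. Qed.

(** A point of line [l] enters slice [l] when traversed upwards, and slice [l - 1], through its top,
    when traversed downwards. *)
Definition next D (x : state) : state :=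
  let i := x.1.1 - ~~ x.2 in
  let p := partner (slice D i) (~~ x.2, x.1.2) in ((i + p.1, p.2), p.1).

Definition in_range D (x : state) : bool := x.1.2 < width D x.1.1.

Lemma next_arc D i s j s' j' : arc (slice D i) (s, j) (s', j') ->
  next D ((i + s, j), ~~ s) = ((i + s', j'), s').
Proof. by move=> /arcE E; rewrite /next /= negbK addnK -E. Qed.

Section Closed.
Variables (D : word T) (cD : closed_word D).

Lemma in_range_level x : in_range D x -> 0 < x.1.1 < size D.
Proof.
have [_ D0] := closed_wordP cD; rewrite /in_range; case: x => [[l j] u] /= h.
have l0 : l <> 0 by move=> E; rewrite E width0 in h.
suff : l < size D by lia.
by case: ltnP => // hl; rewrite width_over // D0 in h.
Qed.

Lemma in_range_partner i (p : bool * nat) : i < size D -> p.2 < width D (i + p.1) ->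
  let q := partner (slice D i) p in q.2 < width D (i + q.1).
Proof.
have [hD _] := closed_wordP cD; move=> hi /=; have := hD i hi.
have := widthS hi; case: (slice D i) p => k b [s j] /= h1 h2.
have E0 : i + false = i by rewrite addn0.
have E1 : i + true = i.+1 by rewrite addn1.
case: s; rewrite ?E0 ?E1 ?h1 => hj; case: ifP => hjk /=;
  rewrite ?E0 ?E1 ?h1; try lia; case: ifP => hjk2 /=; rewrite ?E0 ?E1 ?h1; try lia.
  by case: b h1 h2 hj hjk2 => [||x] /= *; rewrite ?E0 ?E1 ?h1; case: ifP => *; lia.
by case: b h1 h2 hj hjk2 => [||x] /= *; rewrite ?E0 ?E1 ?h1; case: ifP => *; lia.
Qed.

Lemma in_rangeP x : in_range D x ->
  exists2 i, i < size D & exists (s : bool) j, x = ((i + s, j), ~~ s).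
Proof.
case: x => [[l j] u] h; have /= hl := in_range_level h.
exists (l - ~~ u); first by case: u {h}; lia.
exists (~~ u), j; rewrite negbK; congr (_, _, _); case: u {h} => /=; lia.
Qed.

Lemma in_range_next x : in_range D x -> in_range D (next D x) /\ step D x (next D x).
Proof.
move=> h; have [i hi [s [j E]]] := in_rangeP h; subst x.
have ha := arc_partner (slice D i) (s, j).
have := @in_range_partner i (s, j) hi h.
case: (partner _ _) ha => s' j' ha h'.
by rewrite (next_arc ha); split=> //; constructor.
Qed.

(** Reversal conjugates [next] to its inverse; injectivity and predecessors are obtained from
    this. *)
Lemma next_reverse x : in_range D x ->
  next D (reverse (next D x)) = reverse x.
Proof.
move=> h; have [i hi [s [j E]]] := in_rangeP h; subst x.
have ha := arc_partner (slice D i) (s, j).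
case: (partner _ _) ha => s' j' ha.
by rewrite (next_arc ha) /reverse /= (next_arc (arc_sym ha)) negbK.
Qed.

Lemma next_inj x y : in_range D x -> in_range D y ->
  next D x = next D y -> x = y.
Proof.
move=> hx hy E; apply: (can_inj reverseK).
by rewrite -(next_reverse hx) -(next_reverse hy) E.
Qed.

Lemma next_neq_reverse x : in_range D x -> next D x <> reverse x.
Proof.
move=> h; have [i hi [s [j E]]] := in_rangeP h; subst x.
rewrite /next /reverse /= negbK addnK.
case: (slice D i) => k b /=.
case: ifP => ?; first by case=> _; case: (s).
case: ifP => ?; first by case=> _; case: (s).
by case=> _ + _; case: eqP => /= *; lia.
Qed.

Lemma iter_in_range n x : in_range D x -> in_range D (iter n (next D) x).
Proof. by move=> h; elim: n => //= n /in_range_next []. Qed.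

(** A path from [x] to its reverse can be shortened by one step at each end and is then a path from
    [next D x] to its reverse. The descent ends with no step, where a direction would equal its
    opposite, or with one step, where an arc would have equal ends. *)
Lemma no_reversal n x : in_range D x -> iter n (next D) x <> reverse x.
Proof.
elim/ltn_ind: n x => -[|[|n]] IH x h.
- by case: x {h} => p [].
- exact: next_neq_reverse.
rewrite iterS -(next_reverse h) => /next_inj E.
have [hn _] := in_range_next h.
apply: (IH n _ (next D x)) => //; rewrite -iterSr; apply: E.
  exact: iter_in_range.
exact: hn.
Qed.

(** Pigeonhole on the finite list [e] of directed points; injectivity then cancels the steps
    preceding the repeated state. *)
Lemma periodic x : in_range D x -> exists2 p, 0 < p & iter p (next D) x = x.
Proof.
move=> h.
pose e := [seq (p, u) | p <- [seq (l, j) | l <- iota 0 (size D), j <- iota 0 (width D l)],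
  u <- [:: true; false]].
have he n : iter n (next D) x \in e.
  have := iter_in_range n h; case: (iter n _ x) => [[l j] u] hy.
  apply/allpairsP; exists ((l, j), u); split=> //=; last by case: (u).
  apply/allpairsPdep; exists l, j; rewrite !mem_iota /= !add0n.
  by have /andP [_ ->] := in_range_level hy.
pose s := [seq iter n (next D) x | n <- iota 0 (size e).+1].
have : ~~ uniq s.
  apply/negP => us; have hs : {subset s <= e} by move=> y /mapP [n _ ->].
  by have := uniq_leq_size us hs; rewrite size_map size_iota ltnn.
case/(uniqPn x) => a [b [hab]]; rewrite size_map size_iota => hb.
rewrite !(nth_map 0) ?size_iota ?(ltn_trans hab) // !nth_iota ?(ltn_trans hab) //.
rewrite !add0n => E; exists (b - a); first by rewrite subn_gt0.
have {hb} : a <= b by apply: ltnW.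
elim: a b {hab} E => [|a IH] b E hab; first by rewrite subn0 -E.
case: b E hab => // b E hab; rewrite subSS; apply: IH => //.
by apply: next_inj E; apply: iter_in_range.
Qed.


Definition reach x y := exists n, iter n (next D) x = y.

Lemma reach_in_range x y : in_range D x -> reach x y -> in_range D y.
Proof. by move=> hx [n <-]; apply: iter_in_range. Qed.

Lemma reach_arc x i s j s' j' : in_range D x ->
  arc (slice D i) (s, j) (s', j') ->
  reach x ((i + s, j), ~~ s) <-> reach x ((i + s', j'), s').
Proof.
move=> hx ha; split=> [[n E]|[n E]].
  by exists n.+1; rewrite iterS E; apply: next_arc.
have hy : in_range D ((i + s', j'), s') by apply: (reach_in_range hx); exists n.
have hy' : in_range D ((i + s', j'), ~~ s') by [].
have hz : in_range D ((i + s, j), ~~ s).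
  by have [] := in_range_next hy'; rewrite (next_arc (arc_sym ha)).
(* One step back is reached going forward, by a full period less one step. *)
have [p p0 hp] := periodic hx; exists (n + p).-1.
apply: next_inj (iter_in_range _ hx) hz _.
by rewrite (next_arc ha) -iterS prednK ?addn_gt0 ?p0 ?orbT // iterD hp.
Qed.

Definition orbit_label x l j := `[< exists u, reach x ((l, j), u) >].

Lemma orbit_labelling x : in_range D x -> labelling D (orbit_label x).
Proof.
move=> hx i hi.
have H s j s' j' : arc (slice D i) (s, j) (s', j') ->
    orbit_label x (i + s) j -> orbit_label x (i + s') j'.
  move=> ha /asboolP [u hu]; apply/asboolP.
  have [E|E] : u = ~~ s \/ u = s by case: (u); case: (s); by [left|right].
    by exists s'; apply/(reach_arc hx ha); rewrite E in hu.
  by exists (~~ s'); apply/(reach_arc hx (arc_sym ha)); rewrite E in hu.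
move=> s j s' j' ha; have h1 := H _ _ _ _ ha; have h2 := H _ _ _ _ (arc_sym ha).
have E t l : (if t then orbit_label x i.+1 else orbit_label x i) l =
    orbit_label x (i + t) l by case: t; rewrite ?addn0 ?addn1.
by rewrite !E; apply/idP/idP.
Qed.

(** The points met by the orbit, in whatever direction, form a labelling, which is constant on a
    connected diagram. *)
Lemma orbit_full x y : one_component D -> in_range D x -> in_range D y ->
  reach x y \/ reach x (reverse y).
Proof.
move=> kD hx hy.
have := @one_component_labelling _ _ _ x.1 y.1 kD (orbit_labelling hx) hx hy.
have -> : orbit_label x x.1.1 x.1.2 = true.
  by apply/asboolP; exists x.2; exists 0; case: (x) => -[].
move=> /esym/asboolP [u]; case: y {hy} => [[l j] v] /= h.
have [E|E] : u = v \/ u = ~~ v by case: (u); case: (v); by [left|right].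
  by left; rewrite -E.
by right; rewrite /reverse /= -E.
Qed.

(** A point is labelled by whether the orbit of a fixed state passes it upwards. Exactly one
    direction occurs at each point ([U]): at least one by [orbit_full], at most one by
    [no_reversal]. *)
Lemma orientation_exists : one_component D -> exists f, tlab true D f.
Proof.
move=> kD; have [hD _] := closed_wordP cD.
have [x hx] : exists x, in_range D x.
  (* Nothing lies below the first slice, so it is a minimum and line [1] has points. *)
  have [D0 _] := kD; exists ((1, 0), true).
  have h0 : 0 < size D by case: (D) D0.
  have := hD 0 h0; rewrite -[in_range _ _]/(0 < width D 1).
  rewrite (widthS h0) width0; case: (slice D 0) => k [||?] /=; lia.
exists (fun l j => `[< reach x ((l, j), true) >]).
have U l j : in_range D ((l, j), true) ->
    `[< reach x ((l, j), false) >] = ~~ `[< reach x ((l, j), true) >].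
  move=> hy; have := orbit_full kD hx hy; rewrite /reverse /=.
  case: asboolP => h1; case: asboolP => h2 //; last by case.
  move=> _; case: h1 => m Em; case: h2 => n En.
  have hyt := reach_in_range hx (ex_intro _ n En).
  case: (leqP n m) => hnm.
    have := @no_reversal (m - n) _ hyt.
    by rewrite -{1}En -iterD subnK // Em.
  have hyf := reach_in_range hx (ex_intro _ m Em).
  have := @no_reversal (n - m) _ hyf.
  by rewrite -{1}Em -iterD subnK ?En // ltnW.
move=> i hi; have hi' := hD i hi; have wi := widthS hi.
have R s j s' j' : arc (slice D i) (s, j) (s', j') ->
    `[< reach x ((i + s, j), ~~ s) >] = `[< reach x ((i + s', j'), s') >].
  by move=> ha; apply/asbool_equiv_eq/reach_arc.
case: (slice D i) hi' wi R => k b /= hi' wi R; split.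
- by move=> j hj; have := R _ _ _ _ (arc_left b hj); rewrite addn0 addn1.
- by move=> j; have := R _ _ _ _ (arc_right k b j); rewrite addn0 addn1.
case: b hi' wi R => [||y] /= hi' wi R.
- have := R _ _ _ _ (arc_cup _ k); rewrite !addn1 /= => <-.
  by rewrite U ?negbK // /in_range /= wi; lia.
- have := R _ _ _ _ (arc_cap _ k); rewrite !addn0 /= => ->.
  by rewrite U // /in_range /=; lia.
- have := R _ _ _ _ (arc_rising k y); have := R _ _ _ _ (arc_falling k y).
  by rewrite addn0 addn1.
Qed.

Lemma orientation_arc kb r r' s j s' j' : tresp true kb r r' ->
  arc kb (s, j) (s', j') ->
  ((if s then r' else r) j == ~~ s) = ((if s' then r' else r) j' == s').
Proof.
move=> h; move E1: (s, j) => p; move E2: (s', j') => q ha.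
elim: ha h s j s' j' E1 E2 => {p q kb}.
- by move=> k b i hi [h _ _] ? ? ? ? [-> ->] [-> ->]; rewrite h.
- by move=> k b i [_ h _] ? ? ? ? [-> ->] [-> ->]; rewrite h.
- by move=> k [_ _ h] ? ? ? ? [-> ->] [-> ->]; rewrite h; case: (r' _).
- by move=> k [_ _ h] ? ? ? ? [-> ->] [-> ->]; rewrite h; case: (r _).
- by move=> k x [_ _ [h1 h2]] ? ? ? ? [-> ->] [-> ->]; rewrite h1.
- by move=> k x [_ _ [h1 h2]] ? ? ? ? [-> ->] [-> ->]; rewrite h2.
move=> kb p q _ IH h s j s' j' E1 E2; have := IH h _ _ _ _ E2 E1.
by case: (s); case: (s'); case: (r _); case: (r' _); case: (r _); case: (r' _).
Qed.

Lemma orientation_step f x y : tlab true D f -> step D x y ->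
  (f x.1.1 x.1.2 == x.2) = (f y.1.1 y.1.2 == y.2).
Proof.
move=> hf; case=> i s j s' j' hi ha /=.
have := orientation_arc (hf i hi) ha.
by case: (s); case: (s'); rewrite ?addn0 ?addn1.
Qed.

(** Translates [parallel] into a comparison of labels. Agreement with [f] is invariant under a step;
    conversely the orbit of [x] meets [y] in some direction, and the opposite one would have the
    opposite agreement. *)
Lemma travel_orientation f x y : tlab true D f -> one_component D ->
  in_range D x -> in_range D y ->
  travel D x y <-> (f x.1.1 x.1.2 == x.2) = (f y.1.1 y.1.2 == y.2).
Proof.
move=> hf kD hx hy; split.
  by elim=> {x y hx hy} [x y|//|x y z _ -> _ //]; apply: orientation_step.
have T' z : reach x z -> travel D x z.
  case=> n <-; elim: n => [|n IH] /=; first exact: rt_refl.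
  apply: rt_trans IH _; apply: rt_step.
  by have [] := in_range_next (iter_in_range n hx).
case: (orbit_full kD hx hy) => h E; first exact: T'.
have {}h := T' _ h; exfalso.
have : (f x.1.1 x.1.2 == x.2) =
    (f (reverse y).1.1 (reverse y).1.2 == (reverse y).2).
  by elim: h => {x y hx hy E T'} [x y|//|x y z _ -> _ //]; apply: orientation_step.
by rewrite E /=; case: (f _ _); case: (y.2).
Qed.

End Closed.
End Dynamics.

(** * The two resolutions of a crossing *)

Section NotBoth.
Variable T : Type.
Implicit Types (A B D W : word T) (f g h : nat -> nat -> bool).

(** The source of contradictions below: labels outside [W] that extend over [W] without being
    constant on its boundary would disconnect a knot. *)
Lemma tangle_const A W B f g : knot_word (A ++ W ++ B) ->
  tlab false A f -> tlab false B g -> chain false W (f (size A)) (g 0) ->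
  exists c, const_below c (wd 0 A) (f (size A)) /\
            const_below c (wd (wd 0 A) W) (g 0).
Proof.
move=> /andP [cl /asboolP k1] hf hg /chainP [e [he e0 es]].
pose h := glue (size A) f (glue (size W) e g).
have E : f (size A) = glue (size W) e g 0 by rewrite glue_le.
have [D0 _] := k1; have [|c] := proj1 (one_component_const D0 cl) k1 h.
  by apply: tlab_glue => //; apply: tlab_glue.
move=> /const_lab_cat [hA _ hB]; exists c; split.
  by have := hA _ (leqnn _); rewrite take_size /h glue_le.
have := hB 0 isT; rewrite take0 /h -addnA glueD // glueD //.
Qed.

Lemma chain_straight (k : nat) r r' :
  (forall j, j < k -> r j = r' j) ->
  (forall j, r (k + 2 + j) = r' (k + 2 + j)) ->
  r k = r' k -> r k.+1 = r' k.+1 -> chain false ([::] : word T) r r'.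
Proof.
move=> hl hr h1 h2; rewrite chain_nil; apply: funext => j.
have [?|[->|[->|?]]] : j < k \/ j = k \/ j = k.+1 \/ k + 2 <= j by lia.
- exact: hl.
- exact: h1.
- exact: h2.
- by have := hr (j - (k + 2)); rewrite subnKC.
Qed.

Lemma chain_turn_back (k : nat) r r' :
  (forall j, j < k -> r j = r' j) ->
  (forall j, r (k + 2 + j) = r' (k + 2 + j)) ->
  r k = r k.+1 -> r' k = r' k.+1 ->
  chain false ([:: (k, Cap); (k, Cup)] : word T) r r'.
Proof.
move=> hl hr h1 h2; rewrite chain_cap; split=> //.
exists r'; split; last by rewrite chain_nil.
split=> [j hj|j|//]; rewrite /capf /=; first by rewrite hj hl.
by rewrite ifF ?addn0 -?hr; [apply: (congr1 r)|]; lia.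
Qed.

Variables (A B : word T) (k : nat) (y : T).
Let n := size A.
Let D := A ++ [:: (k, Cross y)] ++ B.
Hypothesis kD : knot_word D.

Let cD : closed_word D. Proof. by case/andP: kD. Qed.

Let nD : n < size D. Proof. by rewrite !size_cat /= -/n; lia. Qed.

Let slice_n : slice D n = (k, Cross y).
Proof. by rewrite -[n]addn0 slice_catr. Qed.

Definition at_crossing (j : nat) := (j == k) || (j == k.+1).
(** About to enter the crossing, from below or from above, and thus leaving the part of the curve
    outside it. *)
Definition exiting (z : state) := (z.1.1 == n + ~~ z.2) && at_crossing z.1.2.

Let start : state := ((n.+1, k), true).

Let start_in_range : in_range D start.
Proof.
have [/(_ n nD)] := closed_wordP cD; rewrite slice_n /= => hn _.
by rewrite /in_range /= widthS // slice_n /=; lia.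
Qed.

Let walk i := iter i (next D) start.

Lemma arc_pred i l s j s' j' : arc (slice D l) (s, j) (s', j') ->
  walk i.+1 = ((l + s, j), s) -> walk i = ((l + s', j'), ~~ s').
Proof.
move=> ha E; have hi : in_range D ((l + s, j), ~~ s).
  suff : in_range D ((l + s, j), s) by [].
  by rewrite -E; apply: iter_in_range.
apply: (next_inj cD); first exact: iter_in_range.
  by have [] := in_range_next cD hi; rewrite (next_arc ha).
by rewrite (next_arc (arc_sym ha)) -E.
Qed.

Lemma crossing_arc s j : at_crossing j ->
  exists2 j', at_crossing j' & arc (slice D n) (s, j) (~~ s, j').
Proof.
rewrite slice_n => /orP [] /eqP ->.
  exists k.+1; first by rewrite /at_crossing eqxx orbT.
  by case: s; [apply/arc_sym/arc_falling|apply: arc_rising].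
exists k; first by rewrite /at_crossing eqxx.
by case: s; [apply/arc_sym/arc_rising|apply: arc_falling].
Qed.

Lemma exit_exists : exists m, exiting (walk m).
Proof.
have [[|p] // _ hp] := periodic cD start_in_range; exists p.
have hs : at_crossing k by rewrite /at_crossing eqxx.
have [j' hj' ha] := crossing_arc true hs.
rewrite (arc_pred ha (_ : walk p.+1 = _)) /exiting /= ?eqxx //.
by rewrite addn1.
Qed.

(** Outside the crossing the curve consists of two arcs. The walk up to time [m] covers the one
    issuing from the top left end of the crossing, and [visited] is its indicator. *)
Let m := ex_minn exit_exists.

Let exit_m : exiting (walk m).
Proof. by rewrite /m; case: ex_minnP. Qed.

Let before_m i : exiting (walk i) -> m <= i.
Proof. by rewrite /m; case: ex_minnP => q _ h /h. Qed.

Let visited l j := `[< exists2 i, i <= m & (walk i).1 = (l, j) >].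

Lemma visited_arc l s j s' j' : arc (slice D l) (s, j) (s', j') ->
  (l = n -> ~~ at_crossing j) -> visited (l + s) j -> visited (l + s') j'.
Proof.
move=> ha hl /asboolP [i him E]; apply/asboolP.
have {E} : walk i = ((l + s, j), ~~ s) \/ walk i = ((l + s, j), s).
  by case: (walk i) E => p u /= ->; case: (u); case: (s); by [left|right].
case=> E.
  exists i.+1; last by rewrite /walk iterS -/(walk i) E (next_arc ha).
  move: him; rewrite leq_eqVlt => /orP [/eqP Ei|//].
  have := exit_m; rewrite -Ei E /exiting /= negbK eqn_add2r.
  by move=> /andP [/eqP /hl /negP].
case: i him E => [_ [E1 E2 E3]|i him E].
  have /hl/negP [] : l = n by move: E1; rewrite -E3; lia.
  by rewrite /at_crossing -E2 eqxx.
by exists i; [apply: ltnW|rewrite (arc_pred ha E)].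
Qed.

(** Of the four ends at the crossing, only the two ends of the walk can be marked: any other passage
    would be an earlier re-entry. *)
Lemma visited_end (s : bool) j : at_crossing j -> visited (n + s) j ->
  (n + s, j) = (n.+1, k) \/ (n + s, j) = (walk m).1.
Proof.
move=> hj /asboolP [i him E].
have {E} : walk i = ((n + s, j), ~~ s) \/ walk i = ((n + s, j), s).
  by case: (walk i) E => p u /= ->; case: (u); case: (s); by [left|right].
case=> E.
  have : m <= i by apply: before_m; rewrite E /exiting /= negbK eqxx hj.
  move=> hm; right; have /eqP im : i == m by rewrite eqn_leq him.
  by rewrite -im E.
case: i him E => [_ [-> -> _]|i him E]; first by left.
have [j' hj' ha] := crossing_arc s hj.
have := before_m (i := i); rewrite (arc_pred ha E) /exiting /= negbK hj'.
by rewrite andbT; case: (s); rewrite eqxx => /(_ isT); lia.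
Qed.

Lemma visited_labelling l : l < size D -> l <> n ->
  tresp false (slice D l) (visited l) (visited l.+1).
Proof.
move=> hl ln; apply/respP => s j s' j' ha.
have E t i : (if t then visited l.+1 else visited l) i = visited (l + t) i.
  by case: t; rewrite ?addn0 ?addn1.
by rewrite !E; apply/idP/idP; [apply: visited_arc|apply: visited_arc (arc_sym _) _].
Qed.

Lemma visited_off j : (j < k -> visited n j = visited n.+1 j) /\
  (visited n (k + 2 + j) = visited n.+1 (k + 2 + j)).
Proof.
have H i : ~~ at_crossing i -> arc (slice D n) (false, i) (true, i) ->
    visited n i = visited n.+1 i.
  move=> hi ha; rewrite -[X in visited X _ = _]addn0 -[n.+1]addn1.
  by apply/idP/idP; [apply: (visited_arc ha)|apply: (visited_arc (arc_sym ha))].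
split=> [hj|]; apply: H; rewrite ?slice_n /at_crossing; try lia.
  exact: arc_left.
exact: (arc_right k (Cross y)).
Qed.

(** The arc from the top left end returns to one of the other three ends, [no_reversal] excluding
    the top left one. If it returns bottom left, bottom right or top right, its indicator extends
    over the vertical resolution, the crossing itself or the turned back resolution respectively. It
    marks two of the four ends, so that diagram would be disconnected. *)
Lemma resolve_not_both_cat :
  ~ (knot_word (A ++ [::] ++ B) /\ knot_word (A ++ [:: (k, Cap); (k, Cup)] ++ B)).
Proof.
case=> kV kH.
have hA : tlab false A visited.
  move=> i hi; have := @visited_labelling i; rewrite slice_catl //; apply.
    exact: ltn_trans hi nD.
  by rewrite /n; lia.
have hB : tlab false B (fun l => visited (n.+1 + l)).
  move=> i hi; have := @visited_labelling (n + i.+1).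
  rewrite slice_catr /= !addSnnS !addnS; apply; last by lia.
  by rewrite !size_cat /= -/n; lia.
have vl j : j < k -> visited n j = visited n.+1 j by case: (visited_off j).
have vr j : visited n (k + 2 + j) = visited n.+1 (k + 2 + j).
  by case: (visited_off j).
have v0 : visited n.+1 k by apply/asboolP; exists 0.
have hw : k + 2 <= wd 0 A.
  by move: (cD); rewrite closed_cat /= => /and4P [_ /andP []].
have X W : knot_word (A ++ W ++ B) -> wd (wd 0 A) W = wd 0 A ->
    chain false W (visited n) (visited n.+1) ->
    [/\ visited n k, visited n k.+1 & visited n.+1 k.+1].
  move=> kW wW hW; have := @tangle_const A W B visited _ kW hA hB.
  rewrite addn0 => /(_ hW) [c []]; rewrite wW => h1 h2.
  have ec : c = true by rewrite -(h2 k) //; lia.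
  by split; rewrite (h1, h2) ?ec //; lia.
have EX W (e : visited n k = false \/ visited n k.+1 = false \/
    visited n.+1 k.+1 = false) : knot_word (A ++ W ++ B) ->
    wd (wd 0 A) W = wd 0 A -> chain false W (visited n) (visited n.+1) -> False.
  by move=> kW wW hW; have [] := X W kW wW hW; case: e => [|[|]] ->.
have vm : visited (walk m).1.1 (walk m).1.2.
  by apply/asboolP; exists m => //; case: (walk m) => -[].
have ve (s : bool) j : at_crossing j -> (n + s, j) <> (n.+1, k) ->
    (n + s, j) <> (walk m).1 -> visited (n + s) j = false.
  by move=> hj h1 h2; apply/negP => /(visited_end hj) [].
have N q : q.+1 <> q by move/esym/n_Sn.
have N' q : q <> q.+1 by move/n_Sn.
have a0 : at_crossing k by rewrite /at_crossing eqxx.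
have a1 : at_crossing k.+1 by rewrite /at_crossing eqxx orbT.
have rev := no_reversal cD (n := m) start_in_range; rewrite -/(walk m) in rev.
have := ve false k a0; have := ve false k.+1 a1; have := ve true k.+1 a1.
rewrite !addn0 !addn1; move: exit_m vm rev; rewrite /exiting.
case: (walk m) => -[l j] [] /= /andP [/eqP El /orP [] /eqP Ej]; subst j;
  rewrite ?addn0 ?addn1 in El; subst l => vm rev e1 e2 e3.
- have {}e1 := e1 (fun E => N _ (congr1 snd E)) (fun E => N _ (congr1 fst E)).
  have {}e2 := e2 (fun E => N' _ (congr1 fst E)) (fun E => N _ (congr1 snd E)).
  apply: (EX _ _ kV) => //; first by right; left.
  by apply: (chain_straight vl vr); rewrite ?vm ?v0 ?e1 ?e2.
- have {}e1 := e1 (fun E => N _ (congr1 snd E)) (fun E => N _ (congr1 fst E)).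
  have {}e3 := e3 (fun E => N' _ (congr1 fst E)) (fun E => N' _ (congr1 snd E)).
  apply: (EX _ _ kD) => //; first by left.
    by rewrite -[LHS]/(wd 0 A - 2 + 2) subnK // (leq_trans _ hw) // leq_addl.
  exists (visited n.+1); split; last by rewrite chain_nil.
  by split=> //; rewrite ?vm ?v0 ?e1 ?e3.
- by case: rev.
- have {}e2 := e2 (fun E => N' _ (congr1 fst E)) (fun E => N' _ (congr1 fst E)).
  have {}e3 := e3 (fun E => N' _ (congr1 fst E)) (fun E => N' _ (congr1 fst E)).
  apply: (EX _ _ kH) => //; first by left.
    rewrite -[LHS]/(wd 0 A - 2 + 0 - 0 + 2) addn0 subn0.
    by rewrite subnK // (leq_trans _ hw) // leq_addl.
  by apply: (chain_turn_back vl vr); rewrite ?vm ?v0 ?e2 ?e3.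
Qed.

End NotBoth.

Lemma resolve_not_both T (D : word T) i : knot_word D -> i < size D ->
  is_cross (slice D i).2 ->
  ~~ (knot_word (resolve true D i) && knot_word (resolve false D i)).
Proof.
move=> kD hi; have E : D = take i D ++ [:: slice D i] ++ drop i.+1 D.
  by rewrite /= -drop_nth // cat_take_drop.
rewrite /resolve; case Es: (slice D i) E => [k [||y]] // E _.
by apply/negP => /andP [kV kH];
  apply: (@resolve_not_both_cat _ (take i D) (drop i.+1 D) k y); rewrite -?E.
Qed.

(** * Flat tangles *)

Section FlatTangles.
Implicit Types A B L R P Q W : word fcrossing.

Notation flat_move := (@local_move fcrossing id fr3).

(** [0] unless the word is a diagram of a single curve. *)
Definition cls W : M1u :=
  (if insub W is Some D then << flat_class D >> else 0)%R.

Lemma cls_diagram (D : fdiagram) : cls (val D) = << flat_class D >>%R.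
Proof. by rewrite /cls valK. Qed.

(** Generators are nonzero, so an equality of classes also transfers the property of being a
    knot. *)
Lemma cls_eq0 W : (cls W == 0%R) = ~~ knot_word W.
Proof.
rewrite /cls; case: insubP => [D -> _|/negPf ->]; last by rewrite eqxx.
by rewrite freegU_eq0.
Qed.

Lemma cls_local A L R B : flat_move L R -> closed_word (A ++ L ++ B) ->
  cls (A ++ L ++ B) = cls (A ++ R ++ B).
Proof.
move=> hm cL; have := knot_local hm cL; rewrite /cls.
case: insubP => [D hD eD|/negPf ->]; last first.
  by case: insubP => [D' ->|].
rewrite hD; case: insubP => [D' hD' eD' _|/negPf -> //].
congr (<< _ >>)%R; apply/eqmodP/asboolP; apply: rst_step.
by exists A, L, R, B; rewrite eD eD'.
Qed.

(** Equivalence of tangles with [w] lower ends, tested by all closures. *)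
Definition teq w L R := [/\ fits w L, fits w R, wd w L = wd w R &
  forall A B, closed_word (A ++ L ++ B) -> wd 0 A = w ->
    cls (A ++ L ++ B) = cls (A ++ R ++ B)].

Lemma teq_closed w A L R B : teq w L R -> wd 0 A = w ->
  closed_word (A ++ L ++ B) -> closed_word (A ++ R ++ B).
Proof.
by case=> _ hR hw _ E; rewrite !closed_cat E hR hw => /and4P [-> _ -> ->].
Qed.

Lemma teq_sym w L R : teq w L R -> teq w R L.
Proof.
case=> hL hR hw h; split=> // A B c E; apply: esym; apply: h => //.
by move: c; rewrite !closed_cat E hL hw => /and4P [-> _ -> ->].
Qed.

Lemma teq_trans w L R W : teq w L R -> teq w R W -> teq w L W.
Proof.
move=> h1 h2; have [hL hR hw h] := h1; have [_ hW hw' h'] := h2.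
split=> //; first by rewrite hw.
move=> A B c E; rewrite h //; apply: h' => //.
exact: teq_closed h1 E c.
Qed.

Lemma teq_context w P L R Q : fits w (P ++ L ++ Q) -> teq (wd w P) L R ->
  teq w (P ++ L ++ Q) (P ++ R ++ Q).
Proof.
rewrite !fits_cat => /and3P [hP hL hQ] [_ hR hw h]; split.
- by rewrite !fits_cat hP hL hQ.
- by rewrite !fits_cat hP hR -hw hQ.
- by rewrite !wd_cat hw.
- move=> A B; rewrite -!catA !(catA A) => c E; apply: h => //.
  by rewrite wd_cat E.
Qed.

Lemma teq_move w L R : flat_move L R -> fits w L -> teq w L R.
Proof.
move=> hm hL; have [hR hw] := fits_local hm hL; split=> // A B c _.
exact: cls_local.
Qed.

Lemma teq_step P Q w L R : flat_move L R -> fits w (P ++ L ++ Q) ->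
  teq w (P ++ L ++ Q) (P ++ R ++ Q).
Proof.
move=> hm h; apply: teq_context => //; apply: teq_move => //.
by move: h; rewrite !fits_cat => /and3P [].
Qed.

(** [iso_exchange] with free positions, leaving only linear arithmetic to check. *)
Lemma exchange i j i' j' (a b : brick fcrossing) : i + outs a <= j ->
  j' + outs a = j + ins a -> i' = i ->
  flat_move [:: (i, a); (j, b)] [:: (j', b); (i', a)].
Proof.
move=> h1 h2 ->.
have -> : j = i + outs a + (j - i - outs a) by lia.
have -> : j' = i + ins a + (j - i - outs a) by lia.
exact: iso_exchange.
Qed.

Lemma exchange_resolved w i j j' (a : brick fcrossing) : i + outs a <= j ->
  j' + outs a = j + ins a -> i + ins a <= w -> j' + 2 <= w ->
  teq w [:: (i, a); (j, Cap); (j, Cup)] [:: (j', Cap); (j', Cup); (i, a)].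
Proof.
move=> h1 h2 h3 h4.
apply: (@teq_trans _ _ [:: (j', Cap); (i, a); (j, Cup)]).
  apply: (@teq_step [::] [:: (j, Cup)]
    _ [:: (i, a); (j, Cap)] [:: _; _]) => /=; last by lia.
  by apply: exchange => /=; lia.
apply: (@teq_step [:: (j', Cap)] [::]
  _ [:: (i, a); (j, Cup)] [:: _; _]) => /=; last by lia.
by apply: exchange; lia.
Qed.

Lemma exchange_resolved_l w i j j' (b : brick fcrossing) : i + 2 <= j ->
  j' = j -> i + 2 <= w -> j + ins b <= w ->
  teq w [:: (i, Cap); (i, Cup); (j, b)] [:: (j', b); (i, Cap); (i, Cup)].
Proof.
move=> h1 -> h3 h4.
apply: (@teq_trans _ _ [:: (i, Cap); (j - 2, b); (i, Cup)]).
  apply: (@teq_step [:: (i, Cap)] [::]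
    _ [:: (i, Cup); (j, b)] [:: _; _]) => /=; last by lia.
  by apply: exchange => /=; lia.
apply: (@teq_step [::] [:: (i, Cup)]
  _ [:: (i, Cap); (j - 2, b)] [:: _; _]) => /=; last by lia.
by apply: exchange => /=; lia.
Qed.

(** The kinks of [omega1_r] and [omega1_l] sit on an upright strand. Here a zigzag is inserted
    beside the crossing, which slides along the new maximum until [omega1_l] applies. *)
Lemma curl_cup w k x : k <= w -> teq w [:: (k, Cup); (k, Cross x)] [:: (k, Cup)].
Proof.
move=> hk.
apply: (@teq_trans _ _ [:: (k, Cup); (k, Cross x); (k.+2, Cup); (k.+1, Cap)]).
  apply: teq_sym.
  apply: (@teq_step [:: (k, Cup); (k, Cross x)] [::]
    _ [:: (k.+2, Cup); (k.+1, Cap)] [::]);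
    [exact: iso_zigzag_l|rewrite /=; lia].
apply: (@teq_trans _ _ [:: (k, Cup); (k.+2, Cup); (k, Cross x); (k.+1, Cap)]).
  apply: (@teq_step [:: (k, Cup)] [:: (k.+1, Cap)]
    _ [:: (k, Cross x); (k.+2, Cup)] [:: _; _]);
    [apply: exchange|]; rewrite /=; lia.
apply: (@teq_trans _ _ [:: (k, Cup); (k.+2, Cup); (k.+1, Cross x); (k, Cap)]).
  apply: (@teq_step [:: (k, Cup); (k.+2, Cup)] [::]
    _ [:: (k, Cross x); (k.+1, Cap)] [:: _; _]);
    [exact: iso_slide_cap|rewrite /=; lia].
apply: (@teq_trans _ _ [:: (k, Cup); (k, Cup); (k.+1, Cross x); (k, Cap)]).
  apply: (@teq_step [::] [:: (k.+1, Cross x); (k, Cap)]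
    _ [:: (k, Cup); (k.+2, Cup)] [:: _; _]);
    [apply: exchange|]; rewrite /=; lia.
apply: (@teq_step [:: (k, Cup)] [::]
  _ [:: (k, Cup); (k.+1, Cross x); (k, Cap)] [::]);
  [exact: omega1_l|rewrite /=; lia].
Qed.

Lemma curl_cap w k x : k + 2 <= w -> teq w [:: (k, Cross x); (k, Cap)] [:: (k, Cap)].
Proof.
move=> hk.
apply: (@teq_trans _ _ [:: (k.+1, Cup); (k.+2, Cap); (k, Cross x); (k, Cap)]).
  apply: teq_sym.
  apply: (@teq_step [::] [:: (k, Cross x); (k, Cap)]
    _ [:: (k.+1, Cup); (k.+2, Cap)] [::]);
    [exact: iso_zigzag_r|rewrite /=; lia].
apply: (@teq_trans _ _ [:: (k.+1, Cup); (k, Cross x); (k.+2, Cap); (k, Cap)]).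
  apply: teq_sym.
  apply: (@teq_step [:: (k.+1, Cup)] [:: (k, Cap)]
    _ [:: (k, Cross x); (k.+2, Cap)] [:: _; _]);
    [apply: exchange|]; rewrite /=; lia.
apply: (@teq_trans _ _ [:: (k.+1, Cup); (k, Cross x); (k, Cap); (k, Cap)]).
  apply: teq_sym.
  apply: (@teq_step [:: (k.+1, Cup); (k, Cross x)] [::]
    _ [:: (k, Cap); (k, Cap)] [:: _; _]);
    [apply: exchange|]; rewrite /=; lia.
apply: (@teq_trans _ _ [:: (k, Cup); (k.+1, Cross x); (k, Cap); (k, Cap)]).
  apply: (@teq_step [::] [:: (k, Cap); (k, Cap)]
    _ [:: (k.+1, Cup); (k, Cross x)] [:: _; _]);
    [exact: iso_slide_cup|rewrite /=; lia].
apply: (@teq_step [::] [:: (k, Cap)]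
  _ [:: (k, Cup); (k.+1, Cross x); (k, Cap)] [::]);
  [exact: omega1_l|rewrite /=; lia].
Qed.

Lemma curl_resolved w k x : k + 2 <= w ->
  teq w [:: (k, Cap); (k, Cup); (k, Cross x)] [:: (k, Cross x); (k, Cap); (k, Cup)].
Proof.
move=> hk; apply: (@teq_trans _ _ [:: (k, Cap); (k, Cup)]).
  apply: (@teq_context _ [:: (k, Cap)] [:: (k, Cup); (k, Cross x)]
    [:: (k, Cup)] [::]) => /=; first lia.
  by apply: curl_cup; rewrite /wd /=; lia.
apply: teq_sym.
apply: (@teq_context _ [::] [:: (k, Cross x); (k, Cap)] [:: (k, Cap)]
  [:: (k, Cup)]) => /=; first lia.
exact: curl_cap.
Qed.

Lemma slide_cap_resolved_l w k : k + 3 <= w ->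
  teq w [:: (k, Cap); (k, Cup); (k.+1, Cap)] [:: (k, Cap)].
Proof.
move=> hk; apply: (@teq_step [:: (k, Cap)] [::]
  _ [:: (k, Cup); (k.+1, Cap)] [::]);
  [exact: iso_zigzag_r|rewrite /=; lia].
Qed.

Lemma slide_cap_resolved_r w k : k + 3 <= w ->
  teq w [:: (k.+1, Cap); (k.+1, Cup); (k, Cap)] [:: (k.+1, Cap)].
Proof.
move=> hk; apply: (@teq_step [:: (k.+1, Cap)] [::]
  _ [:: (k.+1, Cup); (k, Cap)] [::]);
  [exact: iso_zigzag_l|rewrite /=; lia].
Qed.

Lemma slide_cup_resolved_l w k : k + 1 <= w ->
  teq w [:: (k.+1, Cup); (k, Cap); (k, Cup)] [:: (k, Cup)].
Proof.
move=> hk; apply: (@teq_step [::] [:: (k, Cup)]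
  _ [:: (k.+1, Cup); (k, Cap)] [::]);
  [exact: iso_zigzag_l|rewrite /=; lia].
Qed.

Lemma slide_cup_resolved_r w k : k + 1 <= w ->
  teq w [:: (k, Cup); (k.+1, Cap); (k.+1, Cup)] [:: (k.+1, Cup)].
Proof.
move=> hk; apply: (@teq_step [::] [:: (k.+1, Cup)]
  _ [:: (k, Cup); (k.+1, Cap)] [::]);
  [exact: iso_zigzag_r|rewrite /=; lia].
Qed.

Lemma omega1_r_resolved w k : k + 1 <= w ->
  teq w [:: (k.+1, Cup); (k, Cap); (k, Cup); (k.+1, Cap)] [::].
Proof.
move=> hk; apply: (@teq_trans _ _ [:: (k, Cup); (k.+1, Cap)]).
  apply: (@teq_step [::] [:: (k, Cup); (k.+1, Cap)]
    _ [:: (k.+1, Cup); (k, Cap)] [::]);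
  [exact: iso_zigzag_l|rewrite /=; lia].
by apply: teq_move; [exact: iso_zigzag_r|rewrite /=; lia].
Qed.

Lemma omega1_l_resolved w k : k + 1 <= w ->
  teq w [:: (k, Cup); (k.+1, Cap); (k.+1, Cup); (k, Cap)] [::].
Proof.
move=> hk; apply: (@teq_trans _ _ [:: (k.+1, Cup); (k, Cap)]).
  apply: (@teq_step [::] [:: (k.+1, Cup); (k, Cap)]
    _ [:: (k, Cup); (k.+1, Cap)] [::]);
  [exact: iso_zigzag_r|rewrite /=; lia].
by apply: teq_move; [exact: iso_zigzag_l|rewrite /=; lia].
Qed.

Section Omega3.
Variables (w k : nat) (t : fcrossing).
Hypothesis hk : k + 3 <= w.

(** Once a real crossing of the triangle is smoothed, the two others have a common flat kind [t].
    The turned back strands slide off them, the crossings cancel by [omega2], and both sides reduce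
    to a maximum at [k] followed by a minimum at [k.+1]. *)
Lemma omega3_resolved12 :
  teq w [:: (k, Cap); (k, Cup); (k.+1, Cross t); (k, Cross t)]
        [:: (k.+1, Cross t); (k, Cross t); (k.+1, Cap); (k.+1, Cup)].
Proof.
apply: (@teq_trans _ _ [:: (k, Cap); (k.+1, Cup)]).
  apply: (@teq_trans _ _ [:: (k, Cap); (k.+1, Cup); (k, Cross t); (k, Cross t)]).
    apply: teq_sym.
    apply: (@teq_step [:: (k, Cap)] [:: (k, Cross t)]
      _ [:: (k.+1, Cup); (k, Cross t)] [:: _; _]);
      [exact: iso_slide_cup|rewrite /=; lia].
  apply: (@teq_step [:: (k, Cap); (k.+1, Cup)] [::]
    _ [:: (k, Cross t); (k, Cross t)] [::]);
    [exact: omega2|rewrite /=; lia].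
apply: teq_sym.
apply: (@teq_trans _ _ [:: (k.+1, Cross t); (k.+1, Cross t); (k, Cap); (k.+1, Cup)]).
  apply: (@teq_step [:: (k.+1, Cross t)] [:: (k.+1, Cup)]
    _ [:: (k, Cross t); (k.+1, Cap)] [:: _; _]);
    [exact: iso_slide_cap|rewrite /=; lia].
apply: (@teq_step [::] [:: (k, Cap); (k.+1, Cup)]
  _ [:: (k.+1, Cross t); (k.+1, Cross t)] [::]);
  [exact: omega2|rewrite /=; lia].
Qed.

(** Here the extrema lie between the two crossings, so nothing cancels: each crossing slides along
    the neighbouring extremum. *)
Lemma omega3_resolved13 :
  teq w [:: (k, Cross t); (k.+1, Cap); (k.+1, Cup); (k, Cross t)]
        [:: (k.+1, Cross t); (k, Cap); (k, Cup); (k.+1, Cross t)].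
Proof.
apply: (@teq_trans _ _ [:: (k.+1, Cross t); (k, Cap); (k.+1, Cup); (k, Cross t)]).
  apply: (@teq_step [::] [:: (k.+1, Cup); (k, Cross t)]
    _ [:: (k, Cross t); (k.+1, Cap)] [:: _; _]);
    [exact: iso_slide_cap|rewrite /=; lia].
apply: (@teq_step [:: (k.+1, Cross t); (k, Cap)] [::]
  _ [:: (k.+1, Cup); (k, Cross t)] [:: _; _]);
  [exact: iso_slide_cup|rewrite /=; lia].
Qed.

Lemma omega3_removed13 :
  teq w [:: (k, Cross t); (k, Cross t)] [:: (k.+1, Cross t); (k.+1, Cross t)].
Proof.
apply: (@teq_trans _ _ [::]); [|apply: teq_sym];
  by apply: teq_move; [exact: omega2|rewrite /=; lia].
Qed.

Lemma omega3_resolved23 :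
  teq w [:: (k, Cross t); (k.+1, Cross t); (k, Cap); (k, Cup)]
        [:: (k.+1, Cap); (k.+1, Cup); (k, Cross t); (k.+1, Cross t)].
Proof.
apply: (@teq_trans _ _ [:: (k.+1, Cap); (k, Cup)]).
  apply: (@teq_trans _ _ [:: (k, Cross t); (k, Cross t); (k.+1, Cap); (k, Cup)]).
    apply: teq_sym.
    apply: (@teq_step [:: (k, Cross t)] [:: (k, Cup)]
      _ [:: (k, Cross t); (k.+1, Cap)] [:: _; _]);
      [exact: iso_slide_cap|rewrite /=; lia].
  apply: (@teq_step [::] [:: (k.+1, Cap); (k, Cup)]
    _ [:: (k, Cross t); (k, Cross t)] [::]);
    [exact: omega2|rewrite /=; lia].
apply: teq_sym.
apply: (@teq_trans _ _ [:: (k.+1, Cap); (k, Cup); (k.+1, Cross t); (k.+1, Cross t)]).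
  apply: (@teq_step [:: (k.+1, Cap)] [:: (k.+1, Cross t)]
    _ [:: (k.+1, Cup); (k, Cross t)] [:: _; _]);
    [exact: iso_slide_cup|rewrite /=; lia].
apply: (@teq_step [:: (k.+1, Cap); (k, Cup)] [::]
  _ [:: (k.+1, Cross t); (k.+1, Cross t)] [::]);
  [exact: omega2|rewrite /=; lia].
Qed.

End Omega3.

End FlatTangles.

(** * Signed sums over crossings *)

Section MapWord.
Variables (T U : Type) (h : T -> U).
Implicit Types D W : word T.

Lemma ins_map_brick b : ins (map_brick h b) = ins b. Proof. by case: b. Qed.
Lemma outs_map_brick b : outs (map_brick h b) = outs b. Proof. by case: b. Qed.

Lemma wd_map_word w W : wd w (map_word h W) = wd w W.
Proof.
by elim: W w => //= kb W IH w; rewrite -IH /wd /= ins_map_brick outs_map_brick.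
Qed.

Lemma fits_map_word w W : fits w (map_word h W) = fits w W.
Proof.
by elim: W w => //= kb W IH w; rewrite IH ins_map_brick outs_map_brick.
Qed.

Lemma closed_map_word W : closed_word (map_word h W) = closed_word W.
Proof. by rewrite !closed_wordE fits_map_word wd_map_word. Qed.

Lemma map_word_cat D W : map_word h (D ++ W) = map_word h D ++ map_word h W.
Proof. exact: map_cat. Qed.

Lemma map_word_resolve v D i : i < size D ->
  map_word h (resolve v D i) = resolve v (map_word h D) i.
Proof.
move=> hi; rewrite /resolve !map_word_cat slice_map_word // /map_word.
by rewrite map_take map_drop; case: v.
Qed.

End MapWord.

Section Resolve.
Variable T : Type.
Implicit Types A B W P Q : word T.

Lemma resolve_catl v A B i : i < size A -> resolve v (A ++ B) i = resolve v A i ++ B.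
Proof.
move=> h; rewrite /resolve slice_catl // -!catA takel_cat ?(ltnW h) //.
by rewrite drop_cat; case: ltnP => // h'; have -> : i.+1 = size A by [lia];
  rewrite subnn drop0 drop_size.
Qed.

Lemma resolve_catr v A B i : resolve v (A ++ B) (size A + i) = A ++ resolve v B i.
Proof.
rewrite /resolve slice_catr take_cat ltnNge leq_addr /= addKn -!catA.
by rewrite drop_cat ltnNge ltnW ?ltnS ?leq_addr //= -addnS addKn.
Qed.

Lemma resolve_fits v w W i : i < size W -> is_cross (slice W i).2 -> fits w W ->
  fits w (resolve v W i) /\ wd w (resolve v W i) = wd w W.
Proof.
move=> hi; have E : W = take i W ++ [:: slice W i] ++ drop i.+1 W.
  by rewrite /= -drop_nth // cat_take_drop.
have eF := congr1 (fits w) E; have eW := congr1 (wd w) E; rewrite {}eF {}eW.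
rewrite /resolve; case: (slice W i) => k [||x] // _.
rewrite !fits_cat !wd_cat; set u := wd w (take i W).
rewrite -![wd u [:: _]]/(u - 2 + 2) /= andbT => /and3P [-> hk hB].
have e : u - 2 + 2 = u by lia.
rewrite e in hB *; case: v; rewrite ?hB //=.
by rewrite !addn0 subn0 e hB hk; split=> //; lia.
Qed.

End Resolve.

Notation fl := (map_word flatten_crossing).

Lemma flatten_local L R : local_move vrot vr3 L R -> local_move id fr3 (fl L) (fl R).
Proof.
case=> [k m a b|k|k|k x|k x|k x|k x|k x|k x y z hr] /=; try by constructor.
- rewrite -(outs_map_brick flatten_crossing a) -(ins_map_brick flatten_crossing a).
  exact: iso_exchange.
- by case: x => [b|]; apply: (@iso_slide_cap _ id).
- by case: x => [b|]; apply: (@iso_slide_cup _ id).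
- by case: x => [b|]; apply: (@omega2 _ id).
- by apply: omega3; move: hr; case: x => [?|]; case: y => [?|]; case: z => [?|].
Qed.

Lemma cls_flatten_local A L R B : local_move vrot vr3 L R ->
  closed_word (A ++ L ++ B) -> cls (fl (A ++ L ++ B)) = cls (fl (A ++ R ++ B)).
Proof.
move=> /flatten_local hm; rewrite -(closed_map_word flatten_crossing).
by rewrite !map_word_cat; apply: cls_local.
Qed.

Section Sums.
Local Open Scope ring_scope.
Implicit Types A B W L R P Q : word vcrossing.
Implicit Types f g : nat -> nat -> bool.

(** Only the agreement of the two labels matters, so both orientations of the knot give the same
    sign. *)
Definition crossing_sign (kb : nat * brick vcrossing) (r : nat -> bool) : int :=
  match kb with
  | (k, Cross (Real b)) => if b == (r k == r k.+1) then 1 else -1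
  | _ => 0
  end.

(** One of the first two terms vanishes, see [resolve_not_both]. *)
Definition smoothing_term A W B i : M1u :=
  cls (fl (A ++ resolve true W i ++ B)) + cls (fl (A ++ resolve false W i ++ B))
  - cls (fl (A ++ W ++ B)).

Definition signed_sum A W B f : M1u :=
  \sum_(0 <= i < size W)
    smoothing_term A W B i *~ crossing_sign (slice W i) (f i).

Lemma crossing_sign_eq0 kb r : ~~ is_real kb.2 -> crossing_sign kb r = 0.
Proof. by case: kb => k [||[]]. Qed.

Lemma real_cross b : is_real b -> is_cross b.
Proof. by case: b => [||[]]. Qed.

Lemma signed_sum_cat P W W' Q f : signed_sum P (W ++ W') Q f =
  signed_sum P W (W' ++ Q) f +
  signed_sum (P ++ W) W' Q (fun l => f (size W + l)%N).
Proof.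
rewrite /signed_sum size_cat (@big_cat_nat _ _ _ (size W)) //= ?leq_addr //.
congr (_ + _).
  apply: eq_big_nat => i /andP [_ hi]; rewrite slice_catl //.
  by rewrite /smoothing_term !resolve_catl // -!catA.
rewrite -{1}[size W]add0n big_addn addKn; apply: eq_bigr => i _.
by rewrite addnC slice_catr /smoothing_term !resolve_catr -!catA.
Qed.

(** For crossings outside the moved tangle. The hypothesis on classes ranges over all words [W']
    with the widths of [W], since it is applied to both resolutions as well as to [W] itself. *)
Lemma eq_signed_sum A W B A' B' f g :
  (forall i, (i < size W)%N -> f i = g i) ->
  (forall W', fits (wd 0 A) W' -> wd (wd 0 A) W' = wd (wd 0 A) W ->
    cls (fl (A ++ W' ++ B)) = cls (fl (A' ++ W' ++ B'))) ->
  fits (wd 0 A) W -> signed_sum A W B f = signed_sum A' W B' g.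
Proof.
move=> hfg hcls hW; apply: eq_big_nat => i /andP [_ hi].
case: (boolP (is_real (slice W i).2))
  => [/real_cross hc|/crossing_sign_eq0 E]; last first.
  by rewrite !E !mulr0z.
have [h1 h2] := resolve_fits true hi hc hW.
have [h3 h4] := resolve_fits false hi hc hW.
by rewrite hfg // /smoothing_term !hcls.
Qed.

Lemma knot_flatten D : knot_word D -> knot_word (fl D).
Proof. exact: knot_map_word. Qed.

Lemma calF_signed_sum (D : vdiagram) f : tlab true (val D) f ->
  calF D = signed_sum [::] (val D) [::] f.
Proof.
move=> hf; have kD := valP D; have /andP [cD /asboolP oD] := kD.
have U (m : int) (x : flat_virtual_knot) : << m *g x >> = << x >> *~ m :> M1u.
  by rewrite freegU_mulz intz.
rewrite /calF /signed_sum U /writhe mulrz_sumr -sumrB.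
pose G i := smoothing_term [::] (val D) [::] i *~ crossing_sign (slice (val D) i) (f i).
transitivity (\sum_(c : real_crossing D) G (val (val c))).
  apply: eq_bigr => c _; rewrite U -mulrzBl; set i := val (val c).
  have hi : (i < size (val D))%N by rewrite ltn_ord.
  have hr : is_real (slice (val D) i).2 by apply: (valP c).
  have hc := real_cross hr.
  have -> : sign c = crossing_sign (slice (val D) i) (f i).
    rewrite /sign /parallel -/i.
    have [hD _] := closed_wordP cD; have := hD i hi.
    case Es: (slice (val D) i) hr => [k [||[b|]]] //= _ hw.
    have -> // : `[< travel (val D) ((i, k), true) ((i, k.+1), true) >]
      = (f i k == f i k.+1).
    have r1 : in_range (val D) ((i, k.+1), true).
      by apply: leq_trans hw; rewrite addn2.
    have r0 : in_range (val D) ((i, k), true) by apply: ltnW r1.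
    have := travel_orientation cD hf oD r0 r1; rewrite /= !eqb_id => E.
    by apply/asboolP/eqP => /E.
  congr (_ *~ _); rewrite /smoothing_term /= !cats0 -!cls_diagram /=; congr (_ - _).
  (* Flattening is only known to carry knots to knots, so the vanishing of the other resolution is
     derived on the flattened word. *)
  have := resolve_not_both (knot_flatten kD) (i := i).
  rewrite size_map slice_map_word // -!map_word_resolve //.
  have hc' : is_cross (map_brick flatten_crossing (slice (val D) i).2).
    by case: (slice (val D) i).2 hc.
  move=> /(_ hi hc'); have := resolve_knot kD hi hc.
  rewrite /smoothing0_word -/i; case: ifP => [kV _|_ /= kH].
    by rewrite knot_flatten //= -cls_eq0 => /eqP ->; rewrite addr0.
  by rewrite andbC knot_flatten //= -cls_eq0 => /eqP ->; rewrite add0r.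
have -> : \sum_(c : real_crossing D) G (val (val c)) =
    \sum_(i < size (val D) | is_real (slice (val D) i).2) G i.
  exact/esym/(big_sub (fun i : 'I_(size (val D)) => is_real (slice (val D) i).2)
    (fun i => G i)).
rewrite big_mkcond big_mkord; apply: eq_bigr => i _.
by case: ifP => // /negbT/crossing_sign_eq0 E; rewrite E mulr0z.
Qed.
End Sums.

(** * Signed sums of the moved tangle *)

Section LocalSums.
Variables (A B : word vcrossing) (w : nat).
Hypothesis wA : wd 0 A = w.
Implicit Types L R W X Y : word vcrossing.
Implicit Types f g : nat -> nat -> bool.

Let Z W := cls (fl (A ++ W ++ B)).

Let term W i := smoothing_term A W B i.

Lemma termE W i : term W i =
  (Z (resolve true W i) + Z (resolve false W i) - Z W)%R.
Proof. by []. Qed.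

Let closes W := closed_word (A ++ W ++ B).

Lemma Z_teq W X Y : closes W -> wd w X = wd w W ->
  teq w (fl X) (fl Y) -> Z X = Z Y.
Proof.
move=> cW hw hX; rewrite /Z !map_word_cat; have [fX fY wXY h] := hX.
apply: h; last by rewrite wd_map_word.
move: cW; rewrite /closes -!map_word_cat closed_map_word !closed_cat wA hw.
by case/and4P=> -> _ -> ->; rewrite -(fits_map_word flatten_crossing) fX.
Qed.

Lemma signed_sum0 f : signed_sum A [::] B f = 0%R.
Proof. by rewrite /signed_sum big_geq. Qed.

Lemma signed_sum2 a b f : signed_sum A [:: a; b] B f =
  (term [:: a; b] 0 *~ crossing_sign a (f 0) +
   term [:: a; b] 1 *~ crossing_sign b (f 1))%R.
Proof. by rewrite /signed_sum !big_nat_recr //= big_geq // add0r. Qed.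

Lemma signed_sum3 a b c f : signed_sum A [:: a; b; c] B f =
  (term [:: a; b; c] 0 *~ crossing_sign a (f 0) +
   term [:: a; b; c] 1 *~ crossing_sign b (f 1) +
   term [:: a; b; c] 2 *~ crossing_sign c (f 2))%R.
Proof. by rewrite /signed_sum !big_nat_recr //= big_geq // add0r. Qed.

Lemma term_exchange_l k m y (b : brick vcrossing) :
  let L := [:: (k, Cross y); (k + 2 + m, b)] in
  let R := [:: (k + 2 + m, b); (k, Cross y)] in
  closes L -> fits w L -> Z L = Z R -> term L 0 = term R 1.
Proof.
move=> L R cL fL ZLR; rewrite !termE ZLR; congr (_ + _ - _)%R.
move: fL; rewrite /L /R /resolve /= => fL.
apply: (Z_teq cL); first by rewrite /wd /=; lia.
rewrite /=; apply: exchange_resolved_l; rewrite ?ins_map_brick; lia.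
Qed.

Lemma term_exchange_r k m (a : brick vcrossing) y :
  let L := [:: (k, a); (k + outs a + m, Cross y)] in
  let R := [:: (k + ins a + m, Cross y); (k, a)] in
  closes L -> fits w L -> Z L = Z R -> term L 1 = term R 0.
Proof.
move=> L R cL fL ZLR; rewrite !termE ZLR; congr (_ + _ - _)%R.
move: fL; rewrite /L /R /resolve /= => fL.
apply: (Z_teq cL); first by rewrite /wd /=; lia.
rewrite /=; apply: exchange_resolved; rewrite ?ins_map_brick ?outs_map_brick; lia.
Qed.

Lemma signed_sum_exchange k m (a b : brick vcrossing) f g :
  let L := [:: (k, a); (k + outs a + m, b)] in
  let R := [:: (k + ins a + m, b); (k, a)] in
  closes L -> fits w L -> Z L = Z R ->
  tlab true L f -> tlab true R g -> f 0 = g 0 ->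
  signed_sum A L B f = signed_sum A R B g.
Proof.
move=> L R cL fL ZLR hf hg E0; rewrite !signed_sum2 [RHS]addrC.
have [fl1 fr1 _] := hf 0 isT; have [gl1 gr1 _] := hg 0 isT.
move: fl1 fr1 gl1 gr1 => /= fl1 fr1 gl1 gr1; congr (_ + _)%R.
  case: a @L @R cL fL ZLR hf hg fl1 fr1 gl1 gr1 => [||[c|]] L R cL fL ZLR
    hf hg fl1 fr1 gl1 gr1;
    rewrite ?mulr0z //.
  congr (_ *~ _)%R; first exact: (term_exchange_l cL fL ZLR).
  by rewrite /crossing_sign -!gl1 ?E0 //=; lia.
case: b @L @R cL fL ZLR hf hg fl1 fr1 gl1 gr1 => [||[c|]] L R cL fL ZLR
    hf hg fl1 fr1 gl1 gr1;
  rewrite ?mulr0z //.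
congr (_ *~ _)%R; first exact: (term_exchange_r cL fL ZLR).
rewrite /crossing_sign -E0 -!addnS.
by rewrite -!fr1.
Qed.

(** The quarter turn exchanges the two resolutions of the crossing. *)
Lemma term_slide_cap k x :
  let L := [:: (k, Cross x); (k.+1, Cap)] in
  let R := [:: (k.+1, Cross (vrot x)); (k, Cap)] in
  closes L -> fits w L -> Z L = Z R -> term L 0 = term R 0.
Proof.
move=> L R cL fL ZLR; rewrite !termE ZLR [X in (X - _)%R]addrC.
congr (_ + _ - _)%R; move: fL; rewrite /L /R /resolve /= => fL.
  apply: (Z_teq cL); first by rewrite /wd /=; lia.
  by rewrite /=; apply: slide_cap_resolved_l; lia.
apply: (Z_teq cL); first by rewrite /wd /=; lia.
by rewrite /=; apply/teq_sym/slide_cap_resolved_r; lia.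
Qed.

Lemma term_slide_cup k x :
  let L := [:: (k.+1, Cup); (k, Cross x)] in
  let R := [:: (k, Cup); (k.+1, Cross (vrot x))] in
  closes L -> fits w L -> Z L = Z R -> term L 1 = term R 1.
Proof.
move=> L R cL fL ZLR; rewrite !termE ZLR [X in (X - _)%R]addrC.
congr (_ + _ - _)%R; move: fL; rewrite /L /R /resolve /= => fL.
  apply: (Z_teq cL); first by rewrite /wd /=; lia.
  by rewrite /=; apply: slide_cup_resolved_l; lia.
apply: (Z_teq cL); first by rewrite /wd /=; lia.
by rewrite /=; apply/teq_sym/slide_cup_resolved_r; lia.
Qed.

(** One resolution of a kink splits off a circle, the other one undoes it. *)
Lemma term_omega1 W i :
  knot_word (A ++ W ++ B) -> i < size W -> is_cross (slice W i).2 ->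
  Z (resolve false W i) = Z W -> term W i = 0%R.
Proof.
move=> kW hi hc E; rewrite termE E addrK; apply/eqP; rewrite cls_eq0.
have := resolve_not_both (knot_flatten kW) (i := size A + i).
have hi' : size A + i < size (A ++ W ++ B) by rewrite !size_cat; lia.
have sl : slice (A ++ W ++ B) (size A + i) = slice W i.
  by rewrite slice_catr slice_catl.
rewrite size_map slice_map_word // sl -!map_word_resolve // !resolve_catr.
rewrite !resolve_catl // => /(_ hi'); case: (slice W i) hc => k [||x] //= _.
move=> /(_ isT); rewrite andbC.
have -> // : knot_word (fl (A ++ resolve false W i ++ B)).
by rewrite -[knot_word _]negbK -cls_eq0 -/(Z _) E cls_eq0 negbK knot_flatten.
Qed.

(** Removing either crossing leaves one crossing of the same flat kind; turning back at either one
    leaves the other as a curl on an extremum, which [curl_resolved] moves from the minimum to the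
    maximum. *)
Lemma term_omega2 k x :
  let L := [:: (k, Cross x); (k, Cross (vrot x))] in
  closes L -> fits w L -> term L 0 = term L 1.
Proof.
move=> L cL fL; rewrite !termE; congr (_ + _ - _)%R.
  by rewrite /Z /L /resolve /= !map_word_cat /=; case: x {L cL fL}.
move: fL; rewrite /L /resolve /= => fL.
apply: (Z_teq cL); first by rewrite /wd /=; lia.
rewrite /= (_ : flatten_crossing (vrot x) = flatten_crossing x); last by case: (x).
by apply: curl_resolved; lia.
Qed.

(** As [vr3] excludes exactly two real crossings, the companions of a real crossing are both real or
    both virtual. This makes their flat kinds equal, as the smoothed tangles require. *)
Lemma term_omega3 k x y z :
  let L := [:: (k, Cross x); (k.+1, Cross y); (k, Cross z)] in
  let R := [:: (k.+1, Cross z); (k, Cross y); (k.+1, Cross x)] in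
  vr3 x y z -> closes L -> fits w L -> Z L = Z R ->
  [/\ is_real (Cross x) -> term L 0 = term R 2,
      is_real (Cross y) -> term L 1 = term R 1 &
      is_real (Cross z) -> term L 2 = term R 0].
Proof.
move=> L R hr cL fL ZLR.
have eyz : is_real (Cross x) -> flatten_crossing y = flatten_crossing z.
  by move: hr; clear; case: x => [?|] //; case: y => [?|]; case: z => [?|].
have exz : is_real (Cross y) -> flatten_crossing x = flatten_crossing z.
  by move: hr; clear; case: x => [?|]; case: y => [?|] //; case: z => [?|].
have exy : is_real (Cross z) -> flatten_crossing x = flatten_crossing y.
  by move: hr; clear; case: x => [?|]; case: y => [?|]; case: z => [?|].
move: fL; rewrite /L /= => fL.
split=> [/eyz e|/exz e|/exy e]; rewrite !termE ZLR;
  congr (_ + _ - _)%R; rewrite /L /R /resolve /=.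
- by rewrite /Z !map_word_cat /= e.
- apply: (Z_teq cL); first by rewrite /wd /=; lia.
  by rewrite /= e; apply: omega3_resolved12; lia.
- apply: (Z_teq cL); first by rewrite /wd /=; lia.
  by rewrite /= e; apply: omega3_removed13; lia.
- apply: (Z_teq cL); first by rewrite /wd /=; lia.
  by rewrite /= e; apply: omega3_resolved13; lia.
- by rewrite /Z !map_word_cat /= e.
- apply: (Z_teq cL); first by rewrite /wd /=; lia.
  by rewrite /= e; apply: omega3_resolved23; lia.
Qed.

Lemma signed_sum_local L R f g : local_move vrot vr3 L R ->
  knot_word (A ++ L ++ B) -> tlab true L f -> tlab true R g ->
  f 0 = g 0 -> f (size L) = g (size R) ->
  signed_sum A L B f = signed_sum A R B g.
Proof.
move=> hm kL; have /andP [cL _] := kL.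
have fL : fits w L by move: (cL); rewrite closed_cat wA => /and4P [].
have ZLR : Z L = Z R by apply: cls_flatten_local.
case: hm kL cL fL ZLR => [k m a b|k|k|k x|k x|k x|k x|k x|k x y z hr]
  kL cL fL ZLR hf hg E0 Es.
- exact: signed_sum_exchange.
- by rewrite signed_sum0 signed_sum2 /= !mulr0z addr0.
- by rewrite signed_sum0 signed_sum2 /= !mulr0z addr0.
- rewrite !signed_sum2 (term_slide_cap cL fL ZLR) /= !mulr0z; congr (_ *~ _ + _)%R.
  case: x hf hg {kL cL fL ZLR Es} => // c hf hg; rewrite /= -E0.
  (* The maximum joins these two strands. Sliding the crossing from one to the other changes whether
     the strands are parallel, which compensates the negated over/under bit. *)
  have -> : f 0 k = ~~ f 0 k.+2.
    have := hf 1 isT; rewrite (tresp_crossE (hf 0 isT)) => /tresp_capE [_].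
    by split_ifs.
  by case: c {hf hg}; case: (f 0 k.+1); case: (f 0 k.+2).
- rewrite !signed_sum2 (term_slide_cup cL fL ZLR) /= !mulr0z; congr (_ + _ *~ _)%R.
  case: x hf hg {kL cL fL ZLR} Es => // c hf hg /=.
  rewrite (tresp_crossE (hf 1 isT)) (tresp_crossE (hg 1 isT)).
  rewrite (tresp_cupE (hf 0 isT)) (tresp_cupE (hg 0 isT)) -E0.
  set u := f 1 _; set v := g 1 _ => /(congr1 (fun r => r k)) E.
  (* Position [k] of the common top line carries the negation of the label of either minimum. *)
  have <- : u = v by move: E; split_ifs; apply: negb_inj.
  have -> : cupf true k.+1 u (f 0) k = f 0 k by split_ifs.
  have -> : cupf true k.+1 u (f 0) k.+1 = ~~ u by split_ifs.
  have -> : cupf true k u (f 0) k.+1 = u by split_ifs.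
  have -> : cupf true k u (f 0) k.+2 = f 0 k by split_ifs; rewrite subn2.
  by case: c {hf hg}; case: (f 0 k); case: (u).
- rewrite signed_sum0 signed_sum3 /= !mulr0z add0r addr0.
  rewrite (term_omega1 kL) ?mul0rz //.
  have /= fL' := fL; rewrite ZLR; apply: (Z_teq cL); first by rewrite /wd /=; lia.
  by rewrite /resolve /=; apply: omega1_r_resolved; lia.
- rewrite signed_sum0 signed_sum3 /= !mulr0z add0r addr0.
  rewrite (term_omega1 kL) ?mul0rz //.
  have /= fL' := fL; rewrite ZLR; apply: (Z_teq cL); first by rewrite /wd /=; lia.
  by rewrite /resolve /=; apply: omega1_l_resolved; lia.
- rewrite signed_sum0 signed_sum2 (term_omega2 cL fL) -mulrzDr /=.
  case: x hf {kL cL fL ZLR hg Es} => [c|] hf; last by rewrite mulr0z.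
  rewrite /= (tresp_crossE (hf 0 isT)).
  have -> : crossf k (f 0) k = f 0 k.+1 by split_ifs.
  have -> : crossf k (f 0) k.+1 = f 0 k by split_ifs.
  by case: c {hf}; case: (f 0 k); case: (f 0 k.+1) => /=; rewrite mulr0z.
- have [t12 t13 t23] := term_omega3 hr cL fL ZLR.
  (* The crossings occur in the opposite order on the right. *)
  rewrite !signed_sum3 [RHS]addrC [X in _ = (_ + X)%R]addrC addrA.
  have f1 := tresp_crossE (hf 0 isT); have f2 := tresp_crossE (hf 1 isT).
  have g1 := tresp_crossE (hg 0 isT); have g2 := tresp_crossE (hg 1 isT).
  congr (_ + _ + _)%R.
  + case: x {hr kL cL fL ZLR hf hg Es t13 t23} t12 => [c /(_ isT) ->|_] /=;
      last by rewrite !mulr0z.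
    congr (_ *~ _)%R; rewrite g2 g1 -E0;
    by congr (if _ == (_ == _) then _ else _); split_ifs.
  + case: y {hr kL cL fL ZLR hf hg Es t12 t23} t13 => [c /(_ isT) ->|_] /=;
      last by rewrite !mulr0z.
    congr (_ *~ _)%R; rewrite f1 g1 -E0;
    by congr (if _ == (_ == _) then _ else _); split_ifs.
  + case: z {hr kL cL fL ZLR hf hg Es t12 t13} t23 => [c /(_ isT) ->|_] /=;
      last by rewrite !mulr0z.
    congr (_ *~ _)%R; rewrite f2 f1 -E0;
    by congr (if _ == (_ == _) then _ else _); split_ifs.
Qed.

End LocalSums.

(** * Invariance under the moves *)

Lemma calF_move (D D' : vdiagram) : move vrot vr3 D D' -> calF D = calF D'.
Proof.
move=> [A [L [R [B [hm eD eD']]]]].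
have kD := valP D; have /andP [cD /asboolP oD] := kD.
have [f hf] := orientation_exists cD oD.
rewrite (calF_signed_sum hf); rewrite eD in kD cD hf *.
have [hA hLB] := tlab_cat hf; have [hL hB] := tlab_cat hLB.
have [g [hg g0 gs]] : exists g, [/\ tlab true R g, g 0 = f (size A) &
    g (size R) = f (size A + size L)].
  apply/chainP/(chain_local _ _ _ hm)/chainP.
  by exists (fun l => f (size A + l)); rewrite addn0.
pose e l := f (size A + (size L + l)).
have ge : g (size R) = e 0 by rewrite gs /e addn0.
have fg : f (size A) = glue (size R) g e 0 by rewrite glue_le.
pose h := glue (size A) f (glue (size R) g e).
have hh : tlab true (val D') h.
  by rewrite eD'; apply: tlab_glue => //; apply: tlab_glue.
have heA l : l <= size A -> h l = f l by move=> hl; rewrite /h glue_le.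
have heR l : l <= size R -> h (size A + l) = g l.
  by move=> hl; rewrite /h glueD // glue_le.
have heB l : h (size A + (size R + l)) = e l by rewrite /h !glueD.
rewrite (calF_signed_sum hh) eD' !signed_sum_cat !cats0 /=.
move: (cD); rewrite closed_cat => /and4P [fA fL fB B0].
have [fR wR] := fits_local hm fL.
congr (_ + (_ + _))%R.
- apply: eq_signed_sum => //; first by move=> i hi; rewrite heA ?(ltnW hi).
  move=> W fW wW /=; apply: cls_flatten_local => //.
  by rewrite closed_cat fW wW fL fB.
- rewrite (signed_sum_local (erefl (wd 0 A)) hm kD hL (g := fun l => h (size A + l))).
  + by [].
  + by move=> i hi /=; rewrite (heR i) ?(ltnW hi) // (heR i.+1) //; apply: hg.
  + by rewrite addn0 heA // heR // g0.
  + by rewrite heR // gs.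
- apply: eq_signed_sum => [i _|W fW wW|]; last by rewrite wd_cat.
    by rewrite heB.
  rewrite !cats0 -!catA; apply: cls_flatten_local => //.
  move: fW wW; rewrite wd_cat => fW wW.
  by rewrite closed_cat fA fL fW wW.
Qed.

Theorem theorem3p2 (K : virtual_knot) (D D' : vdiagram) :
  \pi_virtual_knot D = K -> \pi_virtual_knot D' = K -> calF D = calF D'.
Proof.
move=> <- /esym/eqmodP/asboolP; elim=> {D D'} //.
- exact: calF_move.
- by move=> D1 D2 D3 _ -> _ ->.
Qed.
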